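(* Let $M = cQ + \varepsilon D \in \mathbb{DH}[t]$ be a bounded, monic, reduced motion polynomial with $c \in \mathbb{R}[t]$ monic, $Q,D\in\mathbb{H}[t]$, and $\operatorname{mrpf}(Q) = 1$. Set $g := \operatorname{mrpf}(c,Q^{*}D,DQ^{*}) \in \mathbb{R}[t]$ and $g' := \dfrac{cg}{\operatorname{mrpf}(cg,\nu(D))} \in \mathbb{R}[t]$. Then $Mg'$ admits a factorization into monic linear motion polynomial factors.
   Context: $\mathbb{H}$ denotes the real quaternions with conjugation $q\mapsto q^{*}$. The dual quaternions are $\mathbb{DH}=\mathbb{H}[\varepsilon]/(\varepsilon^2)$, where $\varepsilon$ commutes with everything; $(p+\varepsilon d)^{*}=p^{*}+\varepsilon d^{*}$. In $\mathbb{DH}[t]$ and $\mathbb{H}[t]$ the indeterminate $t$ commutes with all coefficients; $M^{*}$ is obtained by conjugating all coefficients and $\nu(M):=MM^{*}$ is the norm polynomial. Every $M\in\mathbb{DH}[t]$ is uniquely $M=P+\varepsilon D$ with $P,D\in\mathbb{H}[t]$ (primal and dual part). $M$ is a motion polynomial if $MM^{*}\in\mathbb{R}[t]\setminus\{0\}$. Monic means leading coefficient $1$; linear means degree $1$. A real polynomial $F$ divides $M$ if $M=FM'$ for some polynomial $M'$ (so every nonzero real polynomial divides $0$). $\operatorname{mrpf}(A,B,\dots)$ is the greatest common monic real polynomial divisor of $A,B,\dots$ (not all zero), $\operatorname{mrpf}(M):=\operatorname{mrpf}(M,M)$, $\operatorname{mrpf}(0):=1$. $M$ is reduced if $\operatorname{mrpf}(M)=1$.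 A monic reduced motion polynomial $M=P+\varepsilon D$ is bounded if $\operatorname{mrpf}(P)$ has no real zero. A factorization into monic linear motion polynomial factors is a product (possibly empty, equal to $1$) of polynomials $t-h$, $h\in\mathbb{DH}$, each of which is a motion polynomial. *)

(* Defs.v *)
From HB Require Import structures.
From mathcomp Require Import all_boot all_order all_algebra.
From mathcomp Require Import ring.
From mathcomp Require Import boolp classical_sets reals.

Set Implicit Arguments.
Unset Strict Implicit.
Unset Printing Implicit Defensive.

Import GRing.Theory.
Local Open Scope ring_scope.

(* [Quat a b c d] is the quaternion a + b i + c j + d k. *)
Record quat (R : Type) := Quat { q0 : R; q1 : R; q2 : R; q3 : R }.

Section QuaternionAlgebra.
Variable R : comNzRingType.
Local Notation H := (quat R).

Definition tuple_of_quat (x : H) := (q0 x, q1 x, q2 x, q3 x).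
Definition quat_of_tuple (u : R * R * R * R) : H :=
  let: (a, b, c, d) := u in Quat a b c d.

Lemma tuple_of_quatK : cancel tuple_of_quat quat_of_tuple.
Proof. by case. Qed.

HB.instance Definition _ := Choice.copy H (can_type tuple_of_quatK).

Definition qadd (x y : H) : H :=
  Quat (q0 x + q0 y) (q1 x + q1 y) (q2 x + q2 y) (q3 x + q3 y).
Definition qopp (x : H) : H := Quat (- q0 x) (- q1 x) (- q2 x) (- q3 x).
Definition qscale (a : R) (x : H) : H :=
  Quat (a * q0 x) (a * q1 x) (a * q2 x) (a * q3 x).
Definition qmul (x y : H) : H :=
  Quat (q0 x * q0 y - q1 x * q1 y - q2 x * q2 y - q3 x * q3 y)
       (q0 x * q1 y + q1 x * q0 y + q2 x * q3 y - q3 x * q2 y)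
       (q0 x * q2 y - q1 x * q3 y + q2 x * q0 y + q3 x * q1 y)
       (q0 x * q3 y + q1 x * q2 y - q2 x * q1 y + q3 x * q0 y).
Definition qconj (x : H) : H := Quat (q0 x) (- q1 x) (- q2 x) (- q3 x).

Lemma qaddA : associative qadd.
Proof. by case=> ? ? ? ? [? ? ? ?] [? ? ? ?]; rewrite /qadd /= !addrA. Qed.
Lemma qaddC : commutative qadd.
Proof. by case=> ? ? ? ? [? ? ? ?]; congr Quat; rewrite /= addrC. Qed.
Lemma qadd0 : left_id (Quat 0 0 0 0) qadd.
Proof. by case=> ? ? ? ?; rewrite /qadd /= !add0r. Qed.
Lemma qaddN : left_inverse (Quat 0 0 0 0) qopp qadd.
Proof. by case=> ? ? ? ?; rewrite /qadd /= !addNr. Qed.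
HB.instance Definition _ := GRing.isZmodule.Build H qaddA qaddC qadd0 qaddN.

Lemma qmulA : associative qmul.
Proof. by case=> ? ? ? ? [? ? ? ?] [? ? ? ?]; congr Quat => /=; ring. Qed.
Lemma qmul1l : left_id (Quat 1 0 0 0) qmul.
Proof. by case=> ? ? ? ?; congr Quat => /=; ring. Qed.
Lemma qmul1r : right_id (Quat 1 0 0 0) qmul.
Proof. by case=> ? ? ? ?; congr Quat => /=; ring. Qed.
Lemma qmulDl : left_distributive qmul qadd.
Proof. by case=> ? ? ? ? [? ? ? ?] [? ? ? ?]; congr Quat => /=; ring. Qed.
Lemma qmulDr : right_distributive qmul qadd.
Proof. by case=> ? ? ? ? [? ? ? ?] [? ? ? ?]; congr Quat => /=; ring. Qed.
Lemma q1_neq0 : Quat 1 0 0 0 != 0 :> H.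
Proof. by apply/eqP => -[] /eqP; rewrite oner_eq0. Qed.
HB.instance Definition _ :=
  GRing.Zmodule_isNzRing.Build H qmulA qmul1l qmul1r qmulDl qmulDr q1_neq0.

Lemma qscaleA a b (x : H) : qscale a (qscale b x) = qscale (a * b) x.
Proof. by rewrite /qscale /= !mulrA. Qed.
Lemma qscale1 : left_id 1 qscale.
Proof. by case=> ? ? ? ?; rewrite /qscale /= !mul1r. Qed.
Lemma qscaleDr : right_distributive qscale +%R.
Proof. by move=> ? [? ? ? ?] [? ? ? ?]; rewrite /qscale /= !mulrDr. Qed.
Lemma qscaleDl x : {morph qscale^~ x : a b / a + b}.
Proof. by case: x => ? ? ? ? ? ?; rewrite /qscale /= !mulrDl. Qed.
HB.instance Definition _ :=
  GRing.Zmodule_isLmodule.Build R H qscaleA qscale1 qscaleDr qscaleDl.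

Lemma qscaleAl (a : R) (x y : H) : a *: (x * y) = (a *: x) * y.
Proof. by case: x y => ? ? ? ? [? ? ? ?]; congr Quat => /=; ring. Qed.
HB.instance Definition _ := GRing.Lmodule_isLalgebra.Build R H qscaleAl.
Lemma qscaleAr (a : R) (x y : H) : a *: (x * y) = x * (a *: y).
Proof. by case: x y => ? ? ? ? [? ? ? ?]; congr Quat => /=; ring. Qed.
HB.instance Definition _ := GRing.Lalgebra_isAlgebra.Build R H qscaleAr.

End QuaternionAlgebra.

(* [DQuat p d] is the dual quaternion p + eps d, i.e. the class of p + d eps
   in H[eps] / (eps^2). *)
Record dquat (R : Type) := DQuat { primal : quat R; dual : quat R }.

Section DualQuaternionAlgebra.
Variable R : comNzRingType.
Local Notation H := (quat R).
Local Notation DH := (dquat R).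

Definition pair_of_dquat (x : DH) := (primal x, dual x).
Definition dquat_of_pair (u : H * H) : DH := DQuat u.1 u.2.

Lemma pair_of_dquatK : cancel pair_of_dquat dquat_of_pair.
Proof. by case. Qed.

HB.instance Definition _ := Choice.copy DH (can_type pair_of_dquatK).

Definition dqadd (x y : DH) : DH :=
  DQuat (primal x + primal y) (dual x + dual y).
Definition dqopp (x : DH) : DH := DQuat (- primal x) (- dual x).
Definition dqscale (a : R) (x : DH) : DH :=
  DQuat (a *: primal x) (a *: dual x).
Definition dqmul (x y : DH) : DH :=
  DQuat (primal x * primal y) (primal x * dual y + dual x * primal y).
Definition dqconj (x : DH) : DH := DQuat (qconj (primal x)) (qconj (dual x)).
Definition dq_of_quat (p : H) : DH := DQuat p 0.
Definition eps : DH := DQuat 0 1.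

Lemma dqaddA : associative dqadd.
Proof. by case=> ? ? [? ?] [? ?]; rewrite /dqadd /= !addrA. Qed.
Lemma dqaddC : commutative dqadd.
Proof. by case=> ? ? [? ?]; congr DQuat; rewrite /= addrC. Qed.
Lemma dqadd0 : left_id (DQuat 0 0) dqadd.
Proof. by case=> ? ?; rewrite /dqadd /= !add0r. Qed.
Lemma dqaddN : left_inverse (DQuat 0 0) dqopp dqadd.
Proof. by case=> ? ?; rewrite /dqadd /= !addNr. Qed.
HB.instance Definition _ :=
  GRing.isZmodule.Build DH dqaddA dqaddC dqadd0 dqaddN.

Lemma dqmulA : associative dqmul.
Proof.
by case=> ? ? [? ?] [? ?]; rewrite /dqmul /= mulrDr mulrDl !mulrA addrA.
Qed.
Lemma dqmul1l : left_id (DQuat 1 0) dqmul.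
Proof. by case=> ? ?; rewrite /dqmul /= !mul1r mul0r addr0. Qed.
Lemma dqmul1r : right_id (DQuat 1 0) dqmul.
Proof. by case=> ? ?; rewrite /dqmul /= !mulr1 mulr0 add0r. Qed.
Lemma dqmulDl : left_distributive dqmul dqadd.
Proof.
by case=> ? ? [? ?] [? ?]; congr DQuat; rewrite /= !mulrDl // addrACA.
Qed.
Lemma dqmulDr : right_distributive dqmul dqadd.
Proof.
by case=> ? ? [? ?] [? ?]; congr DQuat; rewrite /= !mulrDr // addrACA.
Qed.
Lemma dq1_neq0 : DQuat 1 0 != 0 :> DH.
Proof. by apply/eqP => -[] /eqP; rewrite oner_eq0. Qed.
HB.instance Definition _ :=
  GRing.Zmodule_isNzRing.Build DH dqmulA dqmul1l dqmul1r dqmulDl dqmulDr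
    dq1_neq0.

Lemma dqscaleA a b (x : DH) : dqscale a (dqscale b x) = dqscale (a * b) x.
Proof. by rewrite /dqscale /= !scalerA. Qed.
Lemma dqscale1 : left_id 1 dqscale.
Proof. by case=> ? ?; rewrite /dqscale /= !scale1r. Qed.
Lemma dqscaleDr : right_distributive dqscale +%R.
Proof. by move=> ? [? ?] [? ?]; rewrite /dqscale /= !scalerDr. Qed.
Lemma dqscaleDl x : {morph dqscale^~ x : a b / a + b}.
Proof. by case: x => ? ? ? ?; rewrite /dqscale /= !scalerDl. Qed.
HB.instance Definition _ :=
  GRing.Zmodule_isLmodule.Build R DH dqscaleA dqscale1 dqscaleDr dqscaleDl.

Lemma dqscaleAl (a : R) (x y : DH) : a *: (x * y) = (a *: x) * y.
Proof.
by case: x y => ? ? [? ?]; congr DQuat; rewrite /= ?scalerDr !scalerAl.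
Qed.
HB.instance Definition _ := GRing.Lmodule_isLalgebra.Build R DH dqscaleAl.
Lemma dqscaleAr (a : R) (x y : DH) : a *: (x * y) = x * (a *: y).
Proof.
by case: x y => ? ? [? ?]; congr DQuat; rewrite /= ?scalerDr !scalerAr.
Qed.
HB.instance Definition _ := GRing.Lalgebra_isAlgebra.Build R DH dqscaleAr.

End DualQuaternionAlgebra.

Definition realp (R : nzRingType) (A : algType R) (F : {poly R}) : {poly A} :=
  map_poly (in_alg A) F.

Section RealDivisors.
Variables (R : fieldType) (A : algType R).
Implicit Types (F G : {poly R}) (N : {poly A}) (s : seq {poly A}).

Definition realp_dvd F N := exists N' : {poly A}, N = realp A F * N'.

Definition common_realp_dvd F s := forall N, N \in s -> realp_dvd F N.

Definition is_mrpf s F :=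
  [/\ F \is monic, common_realp_dvd F s
    & forall G, common_realp_dvd G s -> G %| F].

(* If all members of [s] vanish then every G is a common divisor and no F
   satisfies [is_mrpf s F], so the default value implements mrpf(0) = 1. *)
Definition mrpf s : {poly R} := xget 1 (is_mrpf s).

Lemma realpM F G : realp A (F * G) = realp A F * realp A G.
Proof. exact: rmorphM. Qed.

Lemma realp_monic F : F \is monic -> realp A F \is monic.
Proof. exact: monic_map. Qed.

Lemma size_realp F : size (realp A F) = size F.
Proof.
rewrite /realp; have [->|F0] := eqVneq F 0.
  by rewrite rmorph0 !size_poly0.
by rewrite size_poly_eq //= scaler_eq0 oner_eq0 orbF lead_coef_eq0.
Qed.

Lemma realp_comm F N : realp A F * N = N * realp A F.
Proof.
apply/polyP => i; rewrite coefM coefMr; apply: eq_bigr => j _.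
by rewrite coef_map_id0 /= ?scale0r // -scalerAl -scalerAr mul1r mulr1.
Qed.

Lemma realp_dvd_size F N : F \is monic -> N != 0 -> realp_dvd F N ->
  (size F <= size N)%N.
Proof.
move=> Fm N0 [N' defN]; have N'0 : N' != 0.
  by apply: contraNneq N0 => N'0; rewrite defN N'0 mulr0.
rewrite defN size_monicM ?realp_monic // size_realp.
move: N'0; rewrite -size_poly_gt0; case: size => // n _.
by rewrite addnS leq_addr.
Qed.

Lemma realp_dvd_lcm (d F G : {poly R}) N : d != 0 -> coprimep F G ->
  realp_dvd (d * F) N -> realp_dvd (d * G) N -> realp_dvd (d * F * G) N.
Proof.
move=> d0 /Bezout_eq1_coprimepP[[u v] /= uv1] [a Na] [b Nb].
have FaGb : realp A F * a = realp A G * b.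
  apply: (lreg_lead (p := realp A d)).
    move=> x y; rewrite lead_coefE size_realp coef_map /= -!scalerAl !mul1r.
    by apply: scalerI; rewrite -lead_coefE lead_coef_eq0.
  by rewrite !mulrA -!realpM -Na -Nb.
exists (realp A u * b + realp A v * a).
rewrite [LHS]Na !realpM -!mulrA; congr (_ * (_ * _)).
have uv1' : realp A u * realp A F + realp A v * realp A G = 1.
  by rewrite -!realpM -[LHS]rmorphD uv1 [LHS]rmorph1.
rewrite -[LHS]mul1r -uv1' mulrDl mulrDr.
rewrite -!mulrA FaGb; congr (_ + _); rewrite !mulrA -!realpM.
  by rewrite [u * G]mulrC.
by rewrite [v * G]mulrC.
Qed.

Lemma mrpfP s N : N \in s -> N != 0 -> is_mrpf s (mrpf s).
Proof.
move=> Ns N0; apply: xgetPex.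
pose okP n := exists F, [/\ F \is monic, size F = n & common_realp_dvd F s].
pose ok n := `[< okP n >].
have ok1 : exists n, ok n.
  exists 1%N; apply/asboolP; exists 1; rewrite monic1 size_poly1.
  split=> // N1 _.
  by exists N1; rewrite /realp rmorph1 mul1r.
have okb n : ok n -> (n <= size N)%N.
  by move=> /asboolP[F [Fm <- Fs]]; apply: realp_dvd_size => //; apply: Fs.
case: (ex_maxnP ok1 okb) => n /asboolP[F [Fm Fn Fs]] nmax.
exists F; split=> // G Gs.
have F0 : F != 0 by rewrite monic_neq0.
have G0 : G != 0.
  apply: contraNneq N0 => G0; have [N' ->] := Gs N Ns.
  by rewrite G0 /realp rmorph0 mul0r.
pose d := gcdp F G; pose F1 := F %/ d; pose G1 := G %/ d.
have d0 : d != 0 by rewrite gcdp_eq0 negb_and F0.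
have defF : F = F1 * d by rewrite divpK // dvdp_gcdl.
have defG : G = G1 * d by rewrite divpK // dvdp_gcdr.
have G1n0 : G1 != 0 by apply: contraNneq G0 => G10; rewrite defG G10 mul0r.
have FG1s : common_realp_dvd ((lead_coef G1)^-1 *: (F * G1)) s.
  move=> N1 N1s.
  suff [N' ->] : realp_dvd (d * F1 * G1) N1.
    exists (realp A (lead_coef G1)%:P * N').
    rewrite mulrA -realpM -mul_polyC [d * F1]mulrC -defF; congr (realp A _ * _).
    by rewrite mulrAC -polyCM mulVf ?mul1r // lead_coef_eq0.
  apply: realp_dvd_lcm => //; first by apply: coprimep_div_gcd; rewrite F0.
    by rewrite mulrC -defF; apply: Fs.
  by rewrite mulrC -defG; apply: Gs.
have G1c : size G1 = 1.
  apply/eqP; rewrite eqn_leq size_poly_gt0 G1n0 andbT.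
  have /nmax : ok (size ((lead_coef G1)^-1 *: (F * G1))).
    apply/asboolP; exists ((lead_coef G1)^-1 *: (F * G1)); split=> //.
    rewrite monicE lead_coefZ lead_coefM (monicP Fm) mul1r mulVf //.
    by rewrite lead_coef_eq0.
  rewrite size_scale ?invr_eq0 ?lead_coef_eq0 // size_monicM // Fn.
  have : (0 < n)%N by rewrite -Fn size_poly_gt0.
  case: n {Fn nmax} => // n _.
  by rewrite addSn -[in X in (_ <= X -> _)%N]addn1 leq_add2l.
have [a a0 defG1] : exists2 a, a != 0 & G1 = a%:P.
  have G1C : G1 = (G1`_0)%:P by apply: size1_polyC; rewrite G1c.
  by exists G1`_0 => //; rewrite -polyC_eq0 -G1C.
have -> : G = a *: d by rewrite {1}defG defG1 mul_polyC.
by rewrite dvdpZl // dvdp_gcdl.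
Qed.

Lemma is_mrpf_uniq s F G : is_mrpf s F -> is_mrpf s G -> F = G.
Proof.
move=> [Fm Fs Fmax] [Gm Gs Gmax]; apply/eqP; rewrite -eqp_monic //.
by rewrite /eqp Gmax ?Fmax.
Qed.

End RealDivisors.

Definition poly_of_parts (R : comNzRingType) (P D : {poly quat R}) :
    {poly dquat R} :=
  map_poly (@dq_of_quat R) P + (eps R)%:P * map_poly (@dq_of_quat R) D.

Section MotionPolynomials.
Variable R : realType.
Implicit Types M : {poly dquat R}.

Definition primal_part M : {poly quat R} := map_poly (@primal R) M.

Definition dqnorm M : {poly dquat R} := M * map_poly (@dqconj R) M.

Definition qnorm (P : {poly quat R}) : {poly quat R} :=
  P * map_poly (@qconj R) P.

Definition motion_poly M :=
  exists2 F : {poly R}, F != 0 & dqnorm M = realp (dquat R) F.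

Definition reduced M := mrpf [:: M] = 1.

Definition bounded M :=
  [/\ M \is monic, reduced M, motion_poly M
    & forall x : R, ~~ root (mrpf [:: primal_part M]) x].

Definition has_linear_factorization M :=
  exists s : seq (dquat R),
    {in s, forall h, motion_poly ('X - h%:P)} /\
    M = \prod_(h <- s) ('X - h%:P).

End MotionPolynomials.

(* Main.v *)
Require Import Defs.
From HB Require Import structures.
From mathcomp Require Import all_boot all_order all_algebra.
From mathcomp Require Import ring complex.
From mathcomp Require Import reals.

(** Write [nu q = q q^*] and call [N] a quadratic if it is a monic irreducible real
    polynomial of degree two.  Modulo a quadratic, quaternion polynomials are 2x2 matrices
    over the complex field, conjugation is the adjugate and [nu] is the determinant;
    a monic linear [T = t - p] with [nu T = N] becomes a matrix of rank one.

    A linear factor [T + eps E] of norm [N] can be split off [M = cQ + eps D] on the right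
    for free as long as [N] divides [nu (cQ)] but not [cQ]: the remainder of [M]
    modulo [N] has degree one and an invertible leading coefficient
    ([split_linear_factor]).  Hence [M] factors when [c = 1] ([primitive_splits]).  If a
    quadratic [N] divides [c], one needs [D] to be right divisible by [T], which forces
    [N] to divide [nu D].  The condition that survives an induction is
    [c g | nu D] ([norm_condition_splits]), in three cases, up to conjugation, which
    exchanges left and right factors:
    - [N] does not divide [D Q^*].  Then [D = D1 T], and splitting off [T] replaces
      [(c, Q, D)] by [(c / N, Q T^*, D1)] ([peel_coprime]).
    - [N] divides [g], but [N g] does not divide [D Q^*].  Then [T] is a common right factor of
      [Q] and [D], and removing it from both takes a factor [N] out of both [g]
      and [nu D] ([peel_common]).
    - [N g] divides [Q^* D] and [D Q^*].  The common factor [T] still exists, but [g] would not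
      shrink.  Splitting off [T + eps E] for a constant [E] orthogonal to [T] perturbs the
      new dual part just enough to restore the balance ([peel_translation]).

    For an arbitrary [M] the polynomial [g'] measures how much of [c g] is missing from
    [nu D].  For a quadratic [N | g'] pick a generic [T] with [nu T = N].  Then [M T] has
    dual part [D T], whose norm has gained the factor [N], while [c] and [g] are unchanged
    ([extend_right]); if [N g] divides both [c] and [Q^* D], the same holds for [T M] instead.
    By induction [M T (g' / N)] factors, and multiplying by [T^*] gives [M g']
    ([multiple_splits]).

    All computations take place in quaternions and dual quaternions over the commutative ring
    of real polynomials, where divisibility by real polynomials is componentwise; the
    isomorphism [dquat_of_poly] transports them back. *)

Set Implicit Arguments.
Unset Strict Implicit.
Unset Printing Implicit Defensive.

Import Order.TTheory GRing.Theory Num.Theory.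
Local Open Scope ring_scope.

(** * Quaternions over a commutative ring *)

Section Quaternions.
Variable S : comNzRingType.
Implicit Types (a b : S) (p q r : quat S).

Lemma qaddE a b c d a' b' c' d' :
  Quat a b c d + Quat a' b' c' d' = Quat (a + a') (b + b') (c + c') (d + d').
Proof. by []. Qed.

Lemma qoppE a b c d : - Quat a b c d = Quat (- a) (- b) (- c) (- d).
Proof. by []. Qed.

Lemma qmulE a b c d a' b' c' d' :
  Quat a b c d * Quat a' b' c' d' =
  Quat (a * a' - b * b' - c * c' - d * d')
       (a * b' + b * a' + c * d' - d * c')
       (a * c' - b * d' + c * a' + d * b')
       (a * d' + b * c' - c * b' + d * a').
Proof. by []. Qed.

Lemma qscaleE k a b c d :
  k *: Quat a b c d = Quat (k * a) (k * b) (k * c) (k * d).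
Proof. by []. Qed.

Lemma quat0E : 0 = Quat 0 0 0 0 :> quat S. Proof. by []. Qed.
Lemma quat1E : 1 = Quat 1 0 0 0 :> quat S. Proof. by []. Qed.

Definition quatE := (quat0E, quat1E, qaddE, qoppE, qmulE, qscaleE).

Definition nu q : S := q0 q ^+ 2 + q1 q ^+ 2 + q2 q ^+ 2 + q3 q ^+ 2.

Lemma qconjK : involutive (@qconj S).
Proof. by case=> a b c d; rewrite /qconj /= !opprK. Qed.

Lemma qconjM p q : qconj (p * q) = qconj q * qconj p.
Proof.
by case: p q => ? ? ? ? [? ? ? ?]; rewrite /qconj !quatE /=; congr Quat; ring.
Qed.

Lemma qconjD p q : qconj (p + q) = qconj p + qconj q.
Proof.
by case: p q => ? ? ? ? [? ? ? ?]; rewrite /qconj !quatE /=; congr Quat; ring.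
Qed.

Lemma qconjN p : qconj (- p) = - qconj p.
Proof. by case: p => ? ? ? ?; rewrite /qconj !quatE. Qed.

Lemma qconjZ k p : qconj (k *: p) = k *: qconj p.
Proof.
by case: p => ? ? ? ?; rewrite /qconj !quatE /=; congr Quat; ring.
Qed.

Lemma qconj0 : qconj 0 = 0 :> quat S.
Proof. by rewrite /qconj /= oppr0. Qed.

Lemma qconj1 : qconj 1 = 1 :> quat S.
Proof. by rewrite /qconj /= oppr0. Qed.

Lemma mulr_qconj q : q * qconj q = (nu q)%:A.
Proof. by case: q => ? ? ? ?; rewrite /qconj /nu !quatE /=; congr Quat; ring. Qed.

Lemma qconj_mulr q : qconj q * q = (nu q)%:A.
Proof. by case: q => ? ? ? ?; rewrite /qconj /nu !quatE /=; congr Quat; ring. Qed.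

Lemma nuM p q : nu (p * q) = nu p * nu q.
Proof. by case: p q => ? ? ? ? [? ? ? ?]; rewrite /nu !quatE /=; ring. Qed.

Lemma nuZ k q : nu (k *: q) = k ^+ 2 * nu q.
Proof. by case: q => ? ? ? ?; rewrite /nu !quatE /=; ring. Qed.

Lemma nu_conj q : nu (qconj q) = nu q.
Proof. by case: q => ? ? ? ?; rewrite /nu /qconj /=; ring. Qed.

Lemma nuD p q : nu (p + q) = nu p + q0 (p * qconj q) *+ 2 + nu q.
Proof.
by case: p q => ? ? ? ? [? ? ? ?]; rewrite /nu /qconj !quatE /=; ring.
Qed.

Lemma nu0 : nu 0 = 0. Proof. by rewrite /nu /=; ring. Qed.

Lemma q0_conj q : q0 (qconj q) = q0 q. Proof. by []. Qed.
Lemma q0D p q : q0 (p + q) = q0 p + q0 q. Proof. by []. Qed.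
Lemma q0N p : q0 (- p) = - q0 p. Proof. by []. Qed.
Lemma q0Z k p : q0 (k *: p) = k * q0 p. Proof. by []. Qed.

Lemma q0_mulC p q : q0 (p * q) = q0 (q * p).
Proof. by case: p q => ? ? ? ? [? ? ? ?]; rewrite !quatE /=; ring. Qed.

Lemma addr_qconj p : p + qconj p = (q0 p *+ 2)%:A.
Proof. by case: p => ? ? ? ?; rewrite /qconj !quatE /=; congr Quat; ring. Qed.

Lemma qconj_vector p : q0 p = 0 -> qconj p = - p.
Proof. by case: p => ? ? ? ? /= ->; rewrite /qconj quatE /= oppr0. Qed.

Lemma vector_perp p d : q0 d = 0 -> q0 (d * qconj p) = 0 -> qconj p * d = d * p.
Proof.
move=> d0; rewrite q0_mulC => /qconj_vector; rewrite qconjM qconjK qconj_vector //.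
by rewrite mulNr => /oppr_inj.
Qed.

Lemma q0_mul_conj p d : q0 d = 0 -> q0 (d * qconj p) = - q0 (d * p).
Proof. by case: p d => ? ? ? ? [? ? ? ?] /= ->; ring. Qed.

(** Follows from [p r + (p r)^* ] being a scalar. When [p] has norm zero it says
    that [p r p] is a scalar multiple of [p], the quaternion form of the identity [A
    X A = tr(A X) A] for a 2x2 matrix [A] of rank one. *)
Lemma qsandwich p r : p * r * p = (q0 (p * r) *+ 2) *: p - nu p *: qconj r.
Proof.
by case: p r => ? ? ? ? [? ? ? ?]; rewrite /nu /qconj !quatE /=; congr Quat; ring.
Qed.

Lemma mulr_common_qconj p q r : p * r * qconj (q * r) = nu r *: (p * qconj q).
Proof. by rewrite qconjM mulrA -[p * r * _]mulrA mulr_qconj -scalerAr mulr1 -scalerAl. Qed.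

Lemma quat_eqP p q :
  q0 p = q0 q -> q1 p = q1 q -> q2 p = q2 q -> q3 p = q3 q -> p = q.
Proof. by case: p q => ? ? ? ? [? ? ? ?] /= -> -> -> ->. Qed.

End Quaternions.

Section DualQuaternions.
Variable S : comNzRingType.
Implicit Types (m n : dquat S) (p q : quat S).

Lemma dqaddE p d p' d' :
  DQuat p d + DQuat p' d' = DQuat (p + p') (d + d') :> dquat S.
Proof. by []. Qed.

Lemma dqmulE p d p' d' :
  DQuat p d * DQuat p' d' = DQuat (p * p') (p * d' + d * p') :> dquat S.
Proof. by []. Qed.

Lemma dqscaleE k p d : k *: DQuat p d = DQuat (k *: p) (k *: d) :> dquat S.
Proof. by []. Qed.

Lemma dqconjM m n : dqconj (m * n) = dqconj n * dqconj m.
Proof.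
case: m n => p d [p' d']; rewrite dqmulE /dqconj /= dqmulE.
by rewrite !(qconjM, qconjD) addrC.
Qed.

Lemma dqconjK : involutive (@dqconj S).
Proof. by case=> p d; rewrite /dqconj /= !qconjK. Qed.

Lemma mulr_dqconj p d :
  DQuat p d * dqconj (DQuat p d)
  = DQuat (nu p)%:A ((q0 (d * qconj p) *+ 2)%:A).
Proof.
by rewrite -addr_qconj -mulr_qconj qconjM qconjK addrC.
Qed.

End DualQuaternions.

(** * Real polynomial divisors of quaternion polynomials *)

Section Content.
Variable F : fieldType.
Implicit Types (f g a : {poly F}) (p q r : quat {poly F}).

Definition content q := gcdp (gcdp (q0 q) (q1 q)) (gcdp (q2 q) (q3 q)).

Definition dvdq f q := f %| content q.

Lemma dvdqE f q :
  dvdq f q = [&& f %| q0 q, f %| q1 q, f %| q2 q & f %| q3 q].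
Proof. by rewrite /dvdq !dvdp_gcd -!andbA. Qed.

Lemma dvdqP f q : reflect (exists r, q = f *: r) (dvdq f q).
Proof.
rewrite dvdqE; apply: (iffP and4P) => [[]|[r ->]]; last first.
  by split; apply: dvdp_mulr.
move=> /dvdpP[a qa] /dvdpP[b qb] /dvdpP[c qc] /dvdpP[d qd].
exists (Quat a b c d); rewrite qscaleE.
by case: q qa qb qc qd => ? ? ? ? /= -> -> -> ->; congr Quat; rewrite mulrC.
Qed.

Lemma dvdq_trans f g q : f %| g -> dvdq g q -> dvdq f q.
Proof. exact: dvdp_trans. Qed.

Lemma dvdqD f p q : dvdq f p -> dvdq f q -> dvdq f (p + q).
Proof.
by move=> /dvdqP[r ->] /dvdqP[s ->]; apply/dvdqP; exists (r + s); rewrite scalerDr.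
Qed.

Lemma dvdqN f q : dvdq f (- q) = dvdq f q.
Proof. by rewrite !dvdqE /= !dvdpNr. Qed.

Lemma dvdqB f p q : dvdq f p -> dvdq f q -> dvdq f (p - q).
Proof. by move=> fp fq; apply: dvdqD; rewrite ?dvdqN. Qed.

Lemma dvdq_conj f q : dvdq f (qconj q) = dvdq f q.
Proof. by rewrite !dvdqE /= !dvdpNr. Qed.

Lemma dvdqZ f a q : dvdq f q -> dvdq f (a *: q).
Proof.
by move=> /dvdqP[r ->]; apply/dvdqP; exists (a *: r); rewrite !scalerA mulrC.
Qed.

Lemma dvdq_scale f a q : f %| a -> dvdq f (a *: q).
Proof. by move=> /dvdpP[b ->]; apply/dvdqP; exists (b *: q); rewrite scalerA mulrC. Qed.

Lemma dvdqMl f p q : dvdq f q -> dvdq f (p * q).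
Proof. by move=> /dvdqP[r ->]; apply/dvdqP; exists (p * r); rewrite -scalerAr. Qed.

Lemma dvdqMr f p q : dvdq f p -> dvdq f (p * q).
Proof. by move=> /dvdqP[r ->]; apply/dvdqP; exists (r * q); rewrite -scalerAl. Qed.

Lemma dvdq_scale2 a f q : a != 0 -> dvdq (a * f) (a *: q) = dvdq f q.
Proof. by move=> a0; rewrite !dvdqE /= !dvdp_mul2l. Qed.

Lemma Gauss_dvdq f a q : coprimep f a -> dvdq f (a *: q) = dvdq f q.
Proof. by move=> fa; rewrite !dvdqE /= !Gauss_dvdpr. Qed.

Lemma dvdq_q0 f q : dvdq f q -> f %| q0 q.
Proof. by rewrite dvdqE => /and4P[]. Qed.

Lemma dvdq_alg f a : dvdq f a%:A = (f %| a).
Proof. by rewrite dvdqE /= !mulr0 mulr1 !dvdp0 !andbT. Qed.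

Lemma quat_scaleI a p q : a != 0 -> a *: p = a *: q -> p = q.
Proof.
move=> a0; case: p q => ? ? ? ? [? ? ? ?]; rewrite !qscaleE.
by case=> /(mulfI a0)-> /(mulfI a0)-> /(mulfI a0)-> /(mulfI a0)->.
Qed.

(** Dividing by [g] reduces this to the product of two coprime divisors. *)
Lemma dvdp_lcm f g h a :
  g != 0 -> coprimep f h -> g * f %| a -> g * h %| a -> g * f * h %| a.
Proof.
move=> g0 fh gfa; have /dvdpP[b eb] : g %| a by apply: dvdp_trans gfa; apply: dvdp_mulr.
move: gfa; rewrite eb [b * g]mulrC -mulrA !dvdp_mul2l // Gauss_dvdp // => -> ->.
by [].
Qed.

End Content.

(** * Irreducible quadratic polynomials and monic linear quaternion polynomials *)

Section Quadratics.
Variable R : rcfType.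
Implicit Types (f N : {poly R}) (p d : quat R) (P Q D T X : quat {poly R}).

Lemma size2_polyE f : (size f <= 2)%N -> f = f`_1 *: 'X + (f`_0)%:P.
Proof.
move=> sf; apply/polyP => -[|[|i]]; rewrite coefD coefZ coefX coefC /=.
- by rewrite mulr0 add0r.
- by rewrite mulr1 addr0.
by rewrite mulr0 addr0 nth_default // (leq_trans sf).
Qed.

Definition quadratic N := [/\ N \is monic, size N = 3 & irreducible_poly N].

Lemma quadratic_neq0 N : quadratic N -> N != 0.
Proof. by case=> /monic_neq0. Qed.

Lemma quadratic_coprime N f : quadratic N -> ~~ (N %| f) -> coprimep N f.
Proof. by case=> _ _ irrN; rewrite irreducible_poly_coprime. Qed.

(** Irreducible real polynomials remain prime with respect to scalar factors,
    although products of two quaternion polynomials can be divisible without either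
    factor being so. *)
Lemma quadratic_dvdqZ N f Q : quadratic N -> dvdq N (f *: Q) -> (N %| f) || dvdq N Q.
Proof.
move=> qN; have [//|/(quadratic_coprime qN) cNf] := boolP (N %| f).
by rewrite Gauss_dvdq.
Qed.

(** A nonreal complex root and its conjugate give a quadratic factor. *)
Lemma exists_quadratic f : f != 0 -> (1 < size f)%N -> (forall x, ~~ root f x) ->
  exists2 N, quadratic N & N %| f.
Proof.
move=> f0 sf fr; pose fC := map_poly (real_complex R) f.
have /closed_rootP[[x y] fz] : size fC != 1%N.
  by rewrite size_map_poly neq_ltn sf orbT.
have y0 : y != 0.
  apply: contra (fr x) => /eqP y0; move: fz.
  by rewrite y0 -/(real_complex R x) /fC fmorph_root.
pose N : {poly R} := ('X - x%:P) ^+ 2 + (y ^+ 2)%:P.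
have NE : N = 'X^2 + (x *- 2 *: 'X + (x ^+ 2 + y ^+ 2)%:P).
  by rewrite /N -mul_polyC !(polyCD, polyCM, polyCN, polyCMn); ring.
have sN : size N = 3.
  rewrite NE size_polyDl size_polyXn // (leq_ltn_trans (size_polyD _ _)) //.
  rewrite gtn_max (leq_ltn_trans (size_scale_leq _ _)) ?size_polyX //=.
  by rewrite (leq_ltn_trans (size_polyC_leq1 _)).
have mN : N \is monic.
  rewrite NE monicE lead_coefDl ?lead_coefXn //.
  rewrite size_polyXn // (leq_ltn_trans (size_polyD _ _)) //.
  rewrite gtn_max (leq_ltn_trans (size_scale_leq _ _)) ?size_polyX //=.
  by rewrite (leq_ltn_trans (size_polyC_leq1 _)).
exists N.
  split=> //; apply: cubic_irreducible; first by rewrite sN.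
  move=> u; rewrite /root /N !hornerE gt_eqF // ltr_wpDl ?sqr_ge0 //.
  by rewrite lt_def sqr_ge0 sqrf_eq0 y0.
set z := Complex x y in fz.
have Nz : (map_poly (real_complex R) N).[z] = 0.
  rewrite /N rmorphD rmorphXn rmorphB /= map_polyX !map_polyC /= !hornerE.
  by simpc; apply/eqP; rewrite eq_complex /=; apply/andP; split; apply/eqP; ring.
have /size2_polyE : (size (f %% N)%R <= 2)%N.
  by rewrite -ltnS; apply: leq_trans (ltn_modpN0 _ (monic_neq0 mN)) _; rewrite sN.
set u := _`_1; set v := _`_0 => fN.
have : (map_poly (real_complex R) (f %% N)).[z] = 0.
  have := rootP fz; rewrite /fC {1}(divp_eq f N) rmorphD rmorphM /= hornerD hornerM.
  by rewrite Nz mulr0 add0r.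
rewrite fN rmorphD /= map_polyZ map_polyX map_polyC /= !hornerE /z; simpc.
move/eqP; rewrite eq_complex /= => /andP[/eqP uv0 /eqP uy0].
have u0 : u = 0 by move/eqP: uy0; rewrite mulf_eq0 (negPf y0) orbF => /eqP.
have v0 : v = 0 by rewrite -[RHS]uv0 u0; ring.
by rewrite /dvdp fN u0 v0 scale0r add0r.
Qed.



End Quadratics.

Section LinearFactors.
Variable R : rcfType.
Implicit Types (f N : {poly R}) (p d : quat R) (P Q D T X : quat {poly R}).

Definition cst p : quat {poly R} :=
  Quat (q0 p)%:P (q1 p)%:P (q2 p)%:P (q3 p)%:P.

Definition lin p : quat {poly R} := 'X%:A - cst p.

Lemma cstM p d : cst (p * d) = cst p * cst d.
Proof.
case: p d => ? ? ? ? [? ? ? ?]; rewrite /cst !quatE /=.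
by rewrite !(polyCD, polyCM, polyCN).
Qed.

Lemma cstD p d : cst (p + d) = cst p + cst d.
Proof. by rewrite /cst !quatE /= !polyCD. Qed.

Lemma cstN p : cst (- p) = - cst p.
Proof. by rewrite /cst !quatE /= !polyCN. Qed.

Lemma cst_conj p : cst (qconj p) = qconj (cst p).
Proof. by rewrite /cst /qconj /= !polyCN. Qed.

Lemma nu_cst p : nu (cst p) = (nu p)%:P.
Proof. by rewrite /nu /cst /= !(expr2, polyCD, polyCM). Qed.

Lemma nu_eq0 p : (nu p == 0) = (p == 0).
Proof.
apply/eqP/eqP => [|->]; last exact: nu0.
case: p => a b c d; rewrite /nu /= => /eqP.
rewrite !paddr_eq0 ?addr_ge0 ?sqr_ge0 // !sqrf_eq0 -!andbA.
by move=> /and4P[/eqP-> /eqP-> /eqP-> /eqP->].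
Qed.

Lemma cst0 : cst 0 = 0. Proof. by rewrite /cst !quatE. Qed.

Lemma cst1 : cst 1 = 1. Proof. by rewrite /cst !quatE. Qed.

Lemma nu_linE p : nu (lin p) = 'X^2 + (- (q0 p *+ 2) *: 'X + (nu p)%:P).
Proof.
case: p => a b c d; rewrite /nu /lin /cst /= !(expr2, polyCD, polyCM) -mul_polyC.
by rewrite polyCN polyCMn; ring.
Qed.

Lemma size_nu_lin_tail p : (size (- (q0 p *+ 2) *: 'X + (nu p)%:P)%R < 3)%N.
Proof.
rewrite (leq_ltn_trans (size_polyD _ _)) // gtn_max.
rewrite (leq_ltn_trans (size_scale_leq _ _)) ?size_polyX //=.
by rewrite (leq_ltn_trans (size_polyC_leq1 _)).
Qed.

Lemma size_nu_lin p : size (nu (lin p)) = 3.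
Proof. by rewrite nu_linE size_polyDl size_polyXn // size_nu_lin_tail. Qed.

Lemma monic_nu_lin p : nu (lin p) \is monic.
Proof.
by rewrite nu_linE monicE lead_coefDl ?lead_coefXn // size_polyXn size_nu_lin_tail.
Qed.

(** Both are monic of degree two. *)
Lemma dvd_nu_lin N p : quadratic N -> N %| nu (lin p) -> nu (lin p) = N.
Proof.
move=> [mN sN _] Np; apply/esym/eqP; rewrite -eqp_monic ?monic_nu_lin //.
by rewrite -dvdp_size_eqp // sN size_nu_lin.
Qed.

Definition dual_linear h : dquat {poly R} := DQuat (lin (primal h)) (- cst (dual h)).

(** The constants [h] for which [t - h] is a motion polynomial: the scalar part of
    the dual part of [(t - h)(t - h)^*] vanishes identically in [t]. *)
Definition motion_center (h : dquat R) :=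
  q0 (dual h) = 0 /\ q0 (dual h * qconj (primal h)) = 0.

Lemma q0_cst_lin p d :
  q0 (cst d * qconj (lin p)) = q0 d *: 'X - (q0 (d * qconj p))%:P.
Proof.
rewrite /lin qconjD qconjN qconjZ qconj1 mulrDr -scalerAr mulr1 mulrN -cst_conj -cstM.
by rewrite q0D q0N q0Z /= mulrC mul_polyC.
Qed.

Lemma quat_modp N P : N \is monic -> size N = 3 ->
  exists P1 a b, P = N *: P1 + ('X *: cst a + cst b).
Proof.
move=> mN sN; have divE f : f = N * (f %/ N) + ((f %% N)`_1 *: 'X + ((f %% N)`_0)%:P).
  rewrite -size2_polyE; first by rewrite mulrC -divp_eq.
  by rewrite -ltnS -[3%N]sN ltn_modpN0 // monic_neq0.
case: P => x y z t.
exists (Quat (x %/ N) (y %/ N) (z %/ N) (t %/ N)).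
exists (Quat (x %% N)`_1 (y %% N)`_1 (z %% N)`_1 (t %% N)`_1).
exists (Quat (x %% N)`_0 (y %% N)`_0 (z %% N)`_0 (t %% N)`_0).
rewrite /cst !quatE /=; apply: quat_eqP => /=;
  by rewrite mulrC ?['X * _]mulrC mul_polyC mulrC; apply: divE.
Qed.

(** Modulo [N], [P + eps D] is a linear polynomial [a (t - h)]. If the primal part
    of [a] were [0], the primal remainder would be a constant of norm [0], hence
    [0]. So [a] is invertible and [N] divides the norm of [t - h], whose primal part
    is monic of degree two and whose dual part has degree at most one: the norm is
    [N]. Therefore [t - h] is a right factor of [N], and of [P + eps D]. *)
Lemma split_linear_factor N P D : quadratic N -> N %| nu P ->
  N %| q0 (D * qconj P) -> ~~ dvdq N P ->
  exists h, [/\ motion_center h, nu (lin (primal h)) = N &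
    exists m, DQuat P D = m * dual_linear h].
Proof.
move=> qN NP ND NnP; have [mN sN _] := qN.
have [P1 [a [b PE]]] := quat_modp P mN sN.
have [D1 [a' [b' DE]]] := quat_modp D mN sN.
have NPr : N %| nu ('X *: cst a + cst b).
  move: NP; rewrite PE nuD nuZ -scalerAl q0Z dvdp_addr //.
  by rewrite dvdp_add // ?dvdp_mulr // -mulrnAr dvdp_mulr // dvdp_mulr.
have smallN f : (size f <= 2)%N -> N %| f -> f = 0.
  move=> sf Nf; apply/eqP; apply: contraTT Nf => f0.
  by apply/negP => /(dvdp_leq f0); rewrite sN leqNgt ltnS sf.
have a0 : a != 0.
  apply: contra NnP => /eqP a0; move: NPr PE; rewrite a0 cst0 scaler0 add0r nu_cst.
  move=> /smallN; rewrite (leq_trans (size_polyC_leq1 _)) //.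
  move/(_ isT)/eqP; rewrite polyC_eq0 nu_eq0 => /eqP-> ->.
  by rewrite cst0 addr0 dvdq_scale.
pose ai := (nu a)^-1 *: qconj a.
have aai : a * ai = 1.
  by rewrite -scalerAr mulr_qconj scalerA mulVf ?nu_eq0 // scale1r.
(* [p + eps d] solves [(a + eps a') h = - (b + eps b')]. *)
pose p := - (ai * b); pose d := ai * (- b' - a' * p).
have apE : 'X *: cst a + cst b = cst a * lin p.
  rewrite mulrBr -scalerAr mulr1 -cstM; congr (_ + _).
  by rewrite mulrN mulrA aai mul1r cstN opprK.
have adE : 'X *: cst a' + cst b' = cst a' * lin p - cst a * cst d.
  rewrite mulrBr -scalerAr mulr1 -!cstM -addrA; congr (_ + _).
  rewrite [a * _]mulrA aai mul1r -!cstN -cstD; congr cst.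
  by rewrite opprB opprK addKr.
have qa0 : nu a != 0 by rewrite nu_eq0.
have Tn : nu (lin p) = N.
  by apply: dvd_nu_lin => //; move: NPr; rewrite apE nuM nu_cst mul_polyC dvdpZr.
have dualE : N %| q0 (cst d * qconj (lin p)).
  have : N %| q0 ((cst a' * lin p - cst a * cst d) * qconj (cst a * lin p)).
    have -> : cst a' * lin p - cst a * cst d = D - N *: D1.
      by rewrite -adE DE [RHS]addrC addKr.
    have -> : cst a * lin p = P - N *: P1 by rewrite -apE PE [RHS]addrC addKr.
    rewrite qconjD mulrDr q0D dvdp_add //.
      by rewrite mulrDl q0D mulNr -scalerAl q0N dvdp_add // dvdpNr q0Z dvdp_mulr.
    by rewrite qconjN qconjZ mulrN -scalerAr q0N dvdpNr q0Z dvdp_mulr.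
  rewrite qconjM mulrBl q0D q0N.
  rewrite [cst a' * _ * _]mulrA -[cst a' * _ * _]mulrA mulr_qconj Tn.
  rewrite -scalerAr -scalerAl q0Z dvdp_addr ?dvdp_mulr // dvdpNr mulrA.
  rewrite [X in _ %| X -> _]q0_mulC -[cst a * _ * _]mulrA mulrA qconj_mulr -scalerAl mul1r q0Z.
  by rewrite nu_cst mul_polyC dvdpZr.
move: dualE => /smallN; rewrite q0_cst_lin.
have -> : (size (q0 d *: 'X - (q0 (d * qconj p))%:P)%R <= 2)%N.
  rewrite (leq_trans (size_polyD _ _)) // geq_max size_polyN.
  rewrite (leq_trans (size_scale_leq _ _)) ?size_polyX //=.
  by rewrite (leq_trans (size_polyC_leq1 _)).
move=> /(_ isT) low0.
have d0 : q0 d = 0.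
  by move/(congr1 (fun f => f`_1)): low0; rewrite coefB coefZ coefX coefC coef0 mulr1 subr0.
have dp0 : q0 (d * qconj p) = 0.
  move/(congr1 (fun f => f`_0)): low0; rewrite coefB coefZ coefX coefC coef0 mulr0 sub0r.
  by move/eqP; rewrite oppr_eq0 => /eqP.
exists (DQuat p d); split=> //.
exists (DQuat (P1 * qconj (lin p) + cst a) (D1 * qconj (lin p) + cst a' + P1 * cst d)).
rewrite dqmulE; congr DQuat; rewrite /=.
  by rewrite PE apE mulrDl -mulrA qconj_mulr Tn -scalerAr mulr1.
have TdE : qconj (lin p) * cst d = cst d * lin p.
  apply: vector_perp; last by rewrite q0_cst_lin.
  by rewrite /cst /q0 -/(q0 d) d0.
rewrite DE adE mulrN !mulrDl -!mulrA TdE qconj_mulr Tn -scalerAr mulr1.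
rewrite [RHS]addrC -!addrA opprD; congr (_ + (_ + _)).
by rewrite addrA addrN add0r.
Qed.


End LinearFactors.

(** * Splitting off a linear factor when [c] is not constant *)

Section Peeling.
Variable R : rcfType.
Implicit Types (c f g N : {poly R}) (p d : quat R) (Q D T E X : quat {poly R}).

(** The case of zero dual part of the splitting of dual quaternion polynomials. *)
Lemma right_factor N B : quadratic N -> N %| nu B -> ~~ dvdq N B ->
  exists p, nu (lin p) = N /\ exists B1, B = B1 * lin p.
Proof.
move=> qN NB nB.
have N0 : N %| q0 (0 * qconj B) by rewrite mul0r dvdp0.
have [[p d] /= [_ Tn [[B1 D1]]]] := split_linear_factor qN NB N0 nB.
by rewrite dqmulE => -[BE _]; exists p; split=> //; exists B1.
Qed.

(** Modulo [N], the matrix [D1 T] is nonzero with the row space of the rank one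
    matrix [T], so both have the same right annihilator. Concretely [T Z D1 T] is a
    scalar multiple of [T], and the scalar is nonzero modulo [N] for one of the
    basis quaternions [Z]. *)
Lemma right_annihilator N T D1 X : quadratic N -> nu T = N ->
  ~~ dvdq N (D1 * T) -> dvdq N (D1 * T * X) -> dvdq N (T * X).
Proof.
move=> qN Tn nD NX.
have key Z : dvdq N (T * X) || (N %| q0 (Z * (D1 * T))).
  suff : dvdq N ((q0 (Z * (D1 * T)) *+ 2) *: (T * X)).
    by move=> /(quadratic_dvdqZ qN); rewrite -mulr_natl -polyC_natr mul_polyC
      dvdpZr ?pnatr_eq0 // orbC.
  have : dvdq N (T * (Z * D1) * T * X).
    have -> : T * (Z * D1) * T * X = T * Z * (D1 * T * X) by rewrite !mulrA.
    exact: dvdqMl.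
  rewrite qsandwich Tn mulrBl -!scalerAl [q0 (T * _)]q0_mulC -[Z * D1 * T]mulrA.
  move/dvdqD => /(_ _ (dvdq_scale (qconj (Z * D1) * X) (dvdpp N))).
  by rewrite subrK.
apply: contraR nD => /negPf nTX; rewrite dvdqE.
have:= key 1; have := key (Quat 0 1 0 0); have := key (Quat 0 0 1 0).
have := key (Quat 0 0 0 1); rewrite nTX !orFb.
case: (D1 * T) => x y z t; rewrite !quatE /=.
rewrite !(mul0r, mul1r, addr0, add0r, sub0r, subr0, oppr0) !dvdpNr.
by move=> -> -> -> ->.
Qed.

Lemma exists_perp p : exists d, [/\ d != 0, q0 d = 0 & q0 (d * qconj p) = 0].
Proof.
case: p => x y z t; have [y0|y0] := eqVneq y 0.
  exists (Quat 0 1 0 0); split=> //; first by apply/eqP => -[] /eqP; rewrite oner_eq0.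
  by rewrite /qconj y0 !quatE /=; ring.
exists (Quat 0 (- z) y 0); split=> //; last by rewrite /qconj !quatE /=; ring.
by apply/eqP => -[] _ /eqP; rewrite (negPf y0).
Qed.

Definition primitive Q := forall f, dvdq f Q -> f %| 1.

Definition jointly_reduced c D := forall f, f %| c -> dvdq f D -> f %| 1.

Record motion_data c Q D : Prop := MotionData {
  md_noroot : forall x, ~~ root c x;
  md_primitive : primitive Q;
  md_reduced : jointly_reduced c D;
  md_motion : q0 (D * qconj Q) = 0 }.

(** The polynomial [g] of the theorem, up to a constant factor, for [M = cQ + eps
    D]. *)
Definition defect c Q D :=
  gcdp c (gcdp (content (qconj Q * D)) (content (D * qconj Q))).

Lemma dvd_defect f c Q D :
  (f %| defect c Q D) = [&& f %| c, dvdq f (qconj Q * D) & dvdq f (D * qconj Q)].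
Proof. by rewrite /defect dvdp_gcd dvdp_gcd. Qed.

Lemma motion_data_conj c Q D :
  motion_data c Q D -> motion_data c (qconj Q) (qconj D).
Proof.
case=> cr pQ rD mD; split=> // [f|f fc|].
- by rewrite dvdq_conj; apply: pQ.
- by rewrite dvdq_conj; apply: rD.
by rewrite q0_mulC -qconjM q0_conj.
Qed.

Lemma dvd_defect_conj f c Q D : (f %| defect c (qconj Q) (qconj D)) = (f %| defect c Q D).
Proof. by rewrite !dvd_defect -!qconjM !dvdq_conj [X in _ && X]andbC. Qed.

Lemma noroot_neq0 c : (forall x, ~~ root c x) -> c != 0.
Proof. by move=> /(_ 0); apply: contraNneq => ->; rewrite root0. Qed.

Lemma noroot_dvd c f : f %| c -> (forall x, ~~ root c x) -> forall x, ~~ root f x.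
Proof.
move=> /dvdpP[b ->] cr x; apply: contra (cr x) => fx.
by rewrite rootM fx orbT.
Qed.

Lemma quadratic_ndvd1 N : quadratic N -> ~~ (N %| 1).
Proof. by case=> _ sN _; rewrite dvdp1 sN. Qed.

(** Multiplication by [T^*] turns a divisor of [Q T] prime to [N] into one of
    [Q]. *)
Lemma primitive_mulr N T Q : quadratic N -> nu T = N -> primitive Q ->
  ~~ dvdq N (Q * T) -> primitive (Q * T).
Proof.
move=> qN Tn pQ nQT f fQT; apply: pQ.
have cfN : coprimep f N.
  rewrite coprimep_sym; apply: quadratic_coprime => //.
  by apply: contra nQT => Nf; apply: dvdq_trans Nf fQT.
rewrite -(Gauss_dvdq _ cfN) -[Q]mulr1 scalerAr -Tn -mulr_qconj mulrA.
exact: dvdqMr.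
Qed.

Lemma jointly_reduced_mulr N T c D : quadratic N -> nu T = N -> jointly_reduced c D ->
  ~~ ((N %| c) && dvdq N (D * T)) -> jointly_reduced c (D * T).
Proof.
move=> qN Tn rD nDT f fc fDT; apply: rD => //.
have cfN : coprimep f N.
  rewrite coprimep_sym; apply: quadratic_coprime => //.
  apply: contra nDT => Nf; rewrite (dvdp_trans Nf fc).
  by apply: dvdq_trans Nf fDT.
rewrite -(Gauss_dvdq _ cfN) -[D]mulr1 scalerAr -Tn -mulr_qconj mulrA.
exact: dvdqMr.
Qed.

(** One induction step of [norm_condition_splits]. *)
Definition peels c Q D := exists h c' Q' D',
  [/\ motion_center h, motion_data c' Q' D', c' * defect c' Q' D' %| nu D' &
      DQuat (c *: Q) D = DQuat (c' *: Q') D' * dual_linear h].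

Lemma motion_center_quat p : motion_center (DQuat p 0).
Proof. by split; rewrite ?mul0r. Qed.

Lemma dual_linear_quat p : dual_linear (DQuat p 0) = DQuat (lin p) 0.
Proof. by rewrite /dual_linear /= cst0 oppr0. Qed.

(** The dual part of the split factor can be taken to be zero. As [N] divides the
    new [Q T^*] only if it divides [D Q^*], the new [Q] is primitive. The new [g]
    divides [D Q^*], hence is prime to [N] and divides the old one. *)
Lemma peel_coprime N c Q D : quadratic N -> motion_data c Q D ->
  c * defect c Q D %| nu D -> N %| c -> ~~ dvdq N (D * qconj Q) -> peels c Q D.
Proof.
move=> qN mD cgD Nc nDQ; have N0 := quadratic_neq0 qN.
have ND : N %| nu D by apply: dvdp_trans cgD; apply: dvdp_mulr.
have nD : ~~ dvdq N D by apply: contra nDQ => ?; apply: dvdqMr.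
have [p [Tn [D1 DE]]] := right_factor qN ND nD; set T := lin p in Tn DE.
have /dvdpP[c1 cE] := Nc.
have nQT : ~~ dvdq N (Q * qconj T).
  apply: contra nDQ => NQT; rewrite DE -mulrA; apply: dvdqMl.
  by rewrite -dvdq_conj qconjM qconjK.
have D1Q : D1 * qconj (Q * qconj T) = D * qconj Q by rewrite qconjM qconjK mulrA DE.
exists (DQuat p 0), c1, (Q * qconj T), D1; split.
- exact: motion_center_quat.
- case: mD => cr pQ rD mD; split.
  + by apply: noroot_dvd cr; rewrite cE dvdp_mulr.
  + by apply: primitive_mulr nQT => //; rewrite nu_conj.
  + by move=> f fc fD; apply: rD; rewrite ?cE ?DE ?dvdp_mulr ?dvdqMr.
  + by rewrite D1Q.
- rewrite -(dvdp_mul2r _ _ N0) -{2}Tn -nuM -DE; apply: dvdp_trans cgD.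
  rewrite mulrAC -cE; apply: dvdp_mul => //.
  set h := defect _ _ _; have : h %| h by [].
  rewrite {2}/h !dvd_defect D1Q => /and3P[hc1 hQD hDQ].
  rewrite cE dvdp_mulr // hDQ andbT.
  have chN : coprimep h N.
    rewrite coprimep_sym; apply: quadratic_coprime => //.
    by apply: contra nDQ => Nh; apply: dvdq_trans Nh hDQ.
  rewrite -(Gauss_dvdq _ chN).
  have -> : N *: (qconj Q * D) = qconj T * (qconj (Q * qconj T) * D1) * T.
    rewrite DE qconjM qconjK !mulrA qconj_mulr Tn -!scalerAl.
    by rewrite mul1r.
  by rewrite dvdqMr // dvdqMl.
rewrite dual_linear_quat dqmulE mulr0 add0r -DE -/T; congr DQuat.
by rewrite -scalerAl -mulrA qconj_mulr Tn -scalerAr mulr1 scalerA cE.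
Qed.

(** As [D] is nonzero modulo [N] and [D Q^* = 0] modulo [N], the columns of [Q^*]
    are killed by every rank one matrix with the row space of [D]. *)
Lemma common_right_factor N c Q D : quadratic N -> motion_data c Q D ->
  c * defect c Q D %| nu D -> N %| defect c Q D ->
  exists p Q1 D1, [/\ nu (lin p) = N, Q = Q1 * lin p, D = D1 * lin p & ~~ dvdq N D].
Proof.
move=> qN mD cgD; rewrite dvd_defect => /and3P[Nc NQD NDQ].
have ND : N %| nu D by apply: dvdp_trans cgD; apply: dvdp_mulr.
have nD : ~~ dvdq N D.
  by apply: contra (quadratic_ndvd1 qN) => ?; apply: (md_reduced mD).
have [p [Tn [D1 DE]]] := right_factor qN ND nD.
have : dvdq N (lin p * qconj Q).
  by apply: (@right_annihilator N _ D1); rewrite -?DE.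
rewrite -dvdq_conj qconjM qconjK => /dvdqP[Q1 QE].
exists p, Q1, D1; split=> //.
apply: (quat_scaleI (quadratic_neq0 qN)).
by rewrite scalerAl -QE -mulrA qconj_mulr Tn -scalerAr mulr1.
Qed.

(** If [g / h] were prime to [N], then [N h] and [g] would have the least common
    multiple [N g], which would divide [a]. *)
Lemma dvd_absorb N h g a : quadratic N -> h != 0 -> h %| g -> g %| a ->
  N * h %| a -> ~~ (N * g %| a) -> N * h %| g.
Proof.
move=> qN h0 /dvdpP[w ->] ga Nha; apply: contraR => nNhg.
rewrite mulrA mulrC mulrA; apply: dvdp_lcm => //; rewrite 1?mulrC //.
by apply: quadratic_coprime => //; apply: contra nNhg => Nw; rewrite dvdp_mul.
Qed.

(** Cancelling [T] in [D Q^* = N D1 Q1^*] lowers the power of [N] in [D Q^*], hence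
    in [g], by one, as does passing from [nu D] to [nu D1]. *)
Lemma peel_common N c Q D : quadratic N -> motion_data c Q D ->
  c * defect c Q D %| nu D -> N %| defect c Q D -> ~~ dvdq (N * defect c Q D) (D * qconj Q) ->
  peels c Q D.
Proof.
move=> qN mD cgD Ng nDQ; have N0 := quadratic_neq0 qN.
have [p [Q1 [D1 [Tn QE DE _]]]] := common_right_factor qN mD cgD Ng.
set T := lin p in Tn QE DE.
have D1Q : N *: (D1 * qconj Q1) = D * qconj Q.
  by rewrite DE QE mulr_common_qconj Tn.
have c0 := noroot_neq0 (md_noroot mD).
exists (DQuat p 0), c, Q1, D1; split.
- exact: motion_center_quat.
- case: mD => cr pQ rD mD; split=> //.
  + by move=> f fQ; apply: pQ; rewrite QE dvdqMr.
  + by move=> f fc fD; apply: rD; rewrite ?DE ?dvdqMr.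
  + by apply/eqP; have/eqP := mD; rewrite -D1Q q0Z mulf_eq0 (negPf N0).
- rewrite -(dvdp_mul2r _ _ N0) -{2}Tn -nuM -DE; apply: dvdp_trans cgD.
  rewrite -mulrA dvdp_mul2l // mulrC.
  have gDQ : dvdq (defect c Q D) (D * qconj Q).
    by have := dvdpp (defect c Q D); rewrite dvd_defect => /and3P[].
  set h := defect _ _ _; have : h %| h by [].
  rewrite {2}/h dvd_defect => /and3P[hc hQD hDQ].
  apply: (dvd_absorb (a := content (D * qconj Q))) => //.
  + by apply: contraTneq hc => ->; rewrite dvd0p.
  + rewrite dvd_defect hc -D1Q dvdqZ // QE DE qconjM !mulrA.
    by rewrite andbT -[_ * _ * D1]mulrA dvdqMr // dvdqMl.
  + by rewrite -/(dvdq _ _) -D1Q dvdq_scale2.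
by rewrite dual_linear_quat dqmulE mulr0 add0r -DE -/T -scalerAl -QE.
Qed.

End Peeling.

Section Translation.
Variable R : rcfType.
Implicit Types (c f g N : {poly R}) (p d : quat R) (Q D T E X : quat {poly R}).

(** When [N g] divides both products, the power of [N] in [g] is that in [c], and
    cancelling the common right factor [T] alone would lower [nu D] but not [g]. A
    factor [T + eps E] changes the new dual part by [(c / N) Q E], and [Q E Q1^*] is
    nonzero modulo [N] whenever [E] is nonzero. Hence the power of [N] in the new
    [g] is smaller than in [c]. The norm of the new dual part keeps enough factors
    because [T E = E T^*] moves [E] past [T]. *)
Lemma peel_translation N c Q D : quadratic N -> motion_data c Q D ->
  c * defect c Q D %| nu D -> N %| defect c Q D -> ~~ (N * defect c Q D %| c) ->
  dvdq (N * defect c Q D) (qconj Q * D) -> dvdq (N * defect c Q D) (D * qconj Q) ->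
  peels c Q D.
Proof.
move=> qN mD cgD Ng nNgc NgQD NgDQ; have N0 := quadratic_neq0 qN.
have [p [Q1 [D1 [Tn QE DE nD]]]] := common_right_factor qN mD cgD Ng.
have [d [d0 d_vec dp]] := exists_perp p.
have [T Tdef] : {T | T = lin p} by exists (lin p).
rewrite -Tdef in Tn QE DE; pose E := cst d.
have c0 := noroot_neq0 (md_noroot mD).
have [gc gQD gDQ] : [/\ defect c Q D %| c, dvdq (defect c Q D) (qconj Q * D)
    & dvdq (defect c Q D) (D * qconj Q)].
  by have := dvdpp (defect c Q D); rewrite dvd_defect => /and3P[].
have /dvdpP[c1 cE] := dvdp_trans Ng gc.
have E_conj : qconj E = - E by rewrite -cst_conj qconj_vector // cstN.
have E0 : q0 E = 0 by rewrite /E /cst /q0 -/(q0 d) d_vec.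
have ET0 : q0 (E * qconj T) = 0 by rewrite Tdef q0_cst_lin d_vec dp scale0r subr0.
have ET : E * T = qconj T * E by rewrite vector_perp.
have TE : T * E = E * qconj T.
  by rewrite -[T in LHS]qconjK vector_perp // qconjK -[LHS]opprK -q0_mul_conj ?ET0 ?oppr0.
have qE0 : nu E != 0 by rewrite nu_cst polyC_eq0 nu_eq0.
have nQ : ~~ dvdq N Q.
  by apply: contra (quadratic_ndvd1 qN); apply: (md_primitive mD).
pose Z := Q * E * qconj Q1.
have QEE : Q1 * E * qconj T = Q * E by rewrite QE -!mulrA TE.
have nZ : ~~ dvdq N Z.
  apply: contra (nQ); rewrite /Z -mulrA QE => NZ.
  have : dvdq N (T * (E * qconj Q1)) by apply: right_annihilator NZ; rewrite -?QE.
  rewrite -dvdq_conj !qconjM qconjK E_conj mulrN mulNr dvdqN QEE => NQE.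
  have : dvdq N (nu E *: Q).
    by rewrite -[Q]mulr1 scalerAr -mulr_qconj mulrA dvdqMr.
  by rewrite QE nu_cst Gauss_dvdq // -alg_polyC coprimepZr ?coprimep1 // nu_eq0.
(* Determined by [D = D' T - c Q1 E], the dual part of [(c Q1 + eps D') (T - eps E)]. *)
pose D' := D1 + c1 *: (Q * E).
have D'T : D' * T = D + c *: (Q1 * E).
  rewrite /D' mulrDl -DE -scalerAl cE -scalerA; congr (_ + _ *: _).
  rewrite -mulrA ET QE -!mulrA [T * (_ * _)]mulrA mulr_qconj Tn.
  by rewrite -scalerAl mul1r -scalerAr.
have D1Q : N *: (D1 * qconj Q1) = D * qconj Q.
  by rewrite DE QE mulr_common_qconj Tn.
have D'Q : N *: (D' * qconj Q1) = D * qconj Q + c *: Z.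
  by rewrite /D' mulrDl scalerDr D1Q -scalerAl scalerA [N * _]mulrC -cE.
have Z0 : q0 Z = 0.
  rewrite /Z QE -[Q1 * T * E]mulrA TE q0_mulC mulrA qconj_mulr -scalerAl mul1r.
  by rewrite q0Z ET0 mulr0.
have Q1D' : qconj T * (qconj Q1 * D') * T = qconj Q * D + (c * nu Q1) *: (E * T).
  rewrite /D' mulrDr mulrDr mulrDl; congr (_ + _).
    by rewrite DE QE qconjM !mulrA.
  rewrite -!scalerAr -scalerAl [qconj T * (_ * _)]mulrA -qconjM -QE.
  rewrite [qconj Q * _]mulrA qconj_mulr -!scalerAl mul1r scalerA.
  by rewrite QE nuM Tn cE; congr (_ *: _); ring.
have gQ1D : dvdq (defect c Q D) (qconj Q1 * D).
  rewrite -(dvdq_scale2 _ _ N0).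
  have -> : N *: (qconj Q1 * D) = T * (qconj Q * D).
    by rewrite QE qconjM !mulrA mulr_qconj Tn -!scalerAl mul1r.
  exact: dvdqMl.
exists (DQuat p d), c, Q1, D'; split.
- by [].
- case: mD => cr pQ rD mD; split=> //.
  + by move=> f fQ; apply: pQ; rewrite QE dvdqMr.
  + move=> f fc fD'; apply: rD => //.
    have -> : D = D' * T - c *: (Q1 * E) by rewrite D'T addrK.
    by apply: dvdqB; [exact: dvdqMr | exact: dvdq_scale].
  + apply/eqP; rewrite -(mulrI_eq0 _ (mulfI N0)) -q0Z D'Q q0D mD q0Z Z0.
    by rewrite mulr0 addr0.
- set h := defect _ _ _; have : h %| h by [].
  rewrite {2}/h dvd_defect => /and3P[hc hQD hDQ].
  have h0 : h != 0 by apply: contraTneq hc => ->; rewrite dvd0p.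
  have hg : h %| defect c Q D.
    rewrite dvd_defect hc andTb; apply/andP; split.
      have -> : qconj Q * D = qconj T * (qconj Q1 * D') * T - (c * nu Q1) *: (E * T).
        by rewrite Q1D' addrK.
      by apply: dvdqB; [apply/dvdqMr/dvdqMl | apply/dvdq_scale/dvdp_mulr].
    have -> : D * qconj Q = N *: (D' * qconj Q1) - c *: Z by rewrite D'Q addrK.
    by apply: dvdqB; [exact: dvdqZ | exact: dvdq_scale].
  have Nhg : N * h %| defect c Q D.
    apply: dvd_absorb nNgc => //.
    have : dvdq (N * h) (c *: Z).
      have -> : c *: Z = N *: (D' * qconj Q1) - D * qconj Q by rewrite D'Q addrC addKr.
      apply: dvdqB; first by rewrite dvdq_scale2.
      by apply: dvdq_trans NgDQ; rewrite dvdp_mul.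
    have /dvdpP[c2 c2E] := hc; rewrite {1}c2E -scalerA mulrC.
    rewrite [c2 *: _]scalerA [c2 * h]mulrC -scalerA dvdq_scale2 //.
    move/(quadratic_dvdqZ qN); rewrite (negPf nZ) orbF => Nc2.
    by rewrite c2E mulrC dvdp_mul.
  rewrite -(dvdp_mul2l _ _ N0) mulrCA.
  apply: dvdp_trans (dvdp_mul (dvdpp c) Nhg) _.
  have -> : N * nu D' =
      nu D - c * (q0 (qconj Q1 * D * E) *+ 2) + c * (c * nu Q1 * nu E).
    have -> : q0 (qconj Q1 * D * E) = - q0 (D1 * qconj (Q * E)).
      rewrite qconjM E_conj QE qconjM mulNr mulrN q0N opprK [E * (_ * _)]mulrA -TE.
      by rewrite -[qconj Q1 * D * E]mulrA q0_mulC DE !mulrA.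
    rewrite /D' nuD qconjZ -scalerAr q0Z nuZ nuM DE nuM Tn QE nuM Tn cE.
    by ring.
  rewrite dvdp_add // ?dvdp_sub //; first last.
  - by rewrite dvdp_mul // dvdp_mulr // dvdp_mulr.
  - by rewrite dvdp_mul // -mulr_natl dvdp_mull // dvdq_q0 // dvdqMr.
rewrite dqmulE /= -Tdef D'T; congr DQuat; first by rewrite QE scalerAl.
by rewrite mulrN -scalerAl addrC addrK.
Qed.

End Translation.

Section Peel.
Variable R : rcfType.
Implicit Types (c f g N : {poly R}) (p d : quat R) (Q D T E X A B : quat {poly R}).

Lemma norm_condition_conj c Q D a :
  c * defect c Q D %| a -> c * defect c (qconj Q) (qconj D) %| a.
Proof. by apply/dvdp_trans/dvdp_mul => //; rewrite -dvd_defect_conj. Qed.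

(** Conjugation exchanges [Q^* D] and [D Q^*], so that one of the two products may
    be favoured. If [N g] divides both of them it cannot divide [c], by maximality
    of [g]. *)
Lemma peels_or_conj N c Q D : quadratic N -> motion_data c Q D ->
  c * defect c Q D %| nu D -> N %| c -> peels c Q D \/ peels c (qconj Q) (qconj D).
Proof.
move=> qN mD cgD Nc; have mD' := motion_data_conj mD.
have cgD' : c * defect c (qconj Q) (qconj D) %| nu (qconj D).
  by rewrite nu_conj; apply: norm_condition_conj.
have swap f : dvdq f (qconj D * qconj (qconj Q)) = dvdq f (qconj Q * D).
  by rewrite -qconjM dvdq_conj.
have [Ng|] := boolP (N %| defect c Q D); last first.
  rewrite dvd_defect Nc andTb negb_and => /orP[nQD|nDQ]; last by left; apply: peel_coprime nDQ.
  by right; apply: (peel_coprime qN); rewrite ?swap.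
have [NgDQ|nDQ] := boolP (dvdq (N * defect c Q D) (D * qconj Q)); last first.
  by left; apply: peel_common nDQ.
have [NgQD|nQD] := boolP (dvdq (N * defect c Q D) (qconj Q * D)); last first.
  right; apply: (peel_common qN) => //; first by rewrite dvd_defect_conj.
  apply: contra nQD; rewrite swap; apply: dvdq_trans.
  by rewrite dvdp_mul // -dvd_defect_conj !qconjK.
left; apply: (@peel_translation R N) => //.
apply/negP => Ngc; have : N * defect c Q D %| defect c Q D by rewrite dvd_defect Ngc NgQD.
have g0 : defect c Q D != 0.
  by rewrite gcdp_eq0 negb_and noroot_neq0 //; apply: md_noroot mD.
rewrite -{2}[defect c Q D]mul1r dvdp_mul2r //; apply/negP; exact: quadratic_ndvd1.
Qed.

(** * A generic linear factor *)

(** Completing the square; a nonpositive constant term would give a real root. *)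
Lemma quadratic_sqr N : quadratic N ->
  exists x y, y != 0 /\ N = ('X - x%:P) ^+ 2 + (y ^+ 2)%:P.
Proof.
move=> [mN sN irrN]; pose b := N`_1; pose c := N`_0.
have NE : N = 'X^2 + (b *: 'X + c%:P).
  have N2 : N`_2 = 1 by have := monicP mN; rewrite lead_coefE sN.
  apply/polyP => i; rewrite !coefD coefZ coefXn coefX coefC.
  case: i => [|[|[|i]]] /=; rewrite ?N2 ?mulr0 ?mulr1 ?add0r ?addr0 //.
  by rewrite nth_default // sN.
pose x := - b / 2; pose k := c - x ^+ 2.
have NE' : N = ('X - x%:P) ^+ 2 + k%:P.
  have -> : N = 'X^2 + ((- (x *+ 2)) *: 'X + (x ^+ 2 + k)%:P).
    by rewrite NE /k /x; congr (_ + (_ *: _ + _%:P)); field.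
  by rewrite -mul_polyC !(polyCD, polyCM, polyCN, polyCMn); ring.
have k0 : 0 < k.
  rewrite ltNge; apply/negP => k0.
  have : root N (x + Num.sqrt (- k)).
    rewrite /root NE' hornerD horner_exp hornerXsubC hornerC addrAC subrr add0r.
    by rewrite sqr_sqrtr ?oppr_ge0 // addNr.
  rewrite -dvdp_XsubCl => /(apply_irredp irrN); rewrite size_XsubC => /(_ isT).
  by move/eqp_size; rewrite size_XsubC sN.
exists x, (Num.sqrt k); rewrite sqrtr_eq0 -ltNge; split=> //.
by rewrite sqr_sqrtr // ltW.
Qed.

(** The difference of two such products is [B] times a nonzero constant
    quaternion. *)
Lemma dvdq_lin_uniq N B p p' : quadratic N -> ~~ dvdq N B ->
  dvdq N (B * lin p) -> dvdq N (B * lin p') -> p = p'.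
Proof.
move=> qN nB Bp Bp'; apply/eqP; rewrite -subr_eq0; apply: contraR nB => pp'.
have : dvdq N (nu (cst (p - p')) *: B).
  rewrite -[B]mulr1 scalerAr -mulr_qconj mulrA dvdqMr //.
  have -> : cst (p - p') = lin p' - lin p.
    by rewrite cstD cstN /lin opprB [RHS]addrC addrA subrK.
  by rewrite mulrBr dvdqB.
by rewrite nu_cst Gauss_dvdq // -alg_polyC coprimepZr ?coprimep1 // nu_eq0.
Qed.

Lemma count_le1 (T : eqType) (P : pred T) s : uniq s ->
  {in s &, forall u v, P u -> P v -> u = v} -> (count P s <= 1)%N.
Proof.
move=> us Ps; rewrite -size_filter.
case E : (filter P s) => [|u [|v s']] //.
have := filter_uniq P us; rewrite E /= inE negb_or => /andP[/andP[/eqP uv _] _].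
have := mem_filter P u s; have := mem_filter P v s.
rewrite E !inE !eqxx orbT => /esym/andP[Pv vs] /esym/andP[Pu us'].
by case: uv; apply: Ps.
Qed.

(** Five points of the sphere of all [p] whose [lin p] has the norm [(t - x)^2 +
    y^2]; at most four of them will have to be avoided. *)
Definition axis_points x y : seq (quat R) :=
  [:: Quat x y 0 0; Quat x (- y) 0 0; Quat x 0 y 0; Quat x 0 (- y) 0; Quat x 0 0 y].

Lemma axis_points_uniq x y : y != 0 -> uniq (axis_points x y).
Proof.
move=> y0; have yNy : y != - y by rewrite -addr_eq0 -mulr2n mulrn_eq0.
rewrite /= !inE !negb_or; repeat (apply/andP; split=> //); apply/eqP => -[];
  do ?[move/eqP; rewrite ?oppr_eq0 ?(eq_sym 0) ?oppr_eq0 ?(negPf y0) ?(negPf yNy) //].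
Qed.

Lemma nu_axis_points x y :
  {in axis_points x y, forall p, nu (lin p) = ('X - x%:P) ^+ 2 + (y ^+ 2)%:P}.
Proof.
have linN u v w : u ^+ 2 + v ^+ 2 + w ^+ 2 = y ^+ 2 ->
    nu (lin (Quat x u v w)) = ('X - x%:P) ^+ 2 + (y ^+ 2)%:P.
  move=> uvw; rewrite /nu /lin /cst !quatE /= -uvw !polyCD !expr2 !polyCM.
  by ring.
by move=> p; rewrite !inE => /or4P[/eqP->|/eqP->|/eqP->|/orP[]/eqP->];
  apply: linN; ring.
Qed.

(** Over the complex field [{poly R} / N] the [lin p] with [nu (lin p) = N] are the
    matrices [v w^T] of rank one, one for each line [v] of the plane. For trace-free
    [A] the product [(lin p)^* A (lin p)] vanishes exactly when the quadratic form
    [v^T J A v] does, where [J] is the symplectic matrix. This form is nonzero,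
    hence vanishes on at most two lines. For points on the coordinate axes it
    amounts to one linear relation between two components of [A]. *)
Lemma count_sandwich N x y a1 a2 a3 : y != 0 ->
  N = ('X - x%:P) ^+ 2 + (y ^+ 2)%:P -> ~~ dvdq N (Quat 0 a1 a2 a3) ->
  (count (fun p => dvdq N (qconj (lin p) * Quat 0 a1 a2 a3 * lin p)%R) (axis_points x y)
   <= 2)%N.
Proof.
move=> y0 NE nA.
pose t : {poly R} := 'X - x%:P; pose Y := y%:P : {poly R}.
(* Modulo [N], [t] is [Y] times a square root of [-1]. *)
have Ndef : N = t ^+ 2 + Y ^+ 2 by rewrite NE /Y rmorphXn.
have cY f : (N %| Y * f) = (N %| f) by rewrite mul_polyC dvdpZr.
have c2 f : (N %| 2 * f) = (N %| f).
  by rewrite -[2]polyC_natr mul_polyC dvdpZr // pnatr_eq0.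
have two_root u v : (N %| Y * u + t * v) -> (N %| - Y * u + t * v) ->
    (N %| u) && (N %| v).
  move=> H1 H2; have Nu : N %| u.
    rewrite -cY -c2; have -> : 2 * (Y * u) = (Y * u + t * v) - (- Y * u + t * v) by ring.
    by rewrite dvdp_sub.
  rewrite Nu /=; have : N %| t * v by move: H1; rewrite dvdp_addr // dvdp_mull.
  move=> Ntv; rewrite -cY -cY.
  have -> : Y * (Y * v) = N * v - t * (t * v) by rewrite Ndef; ring.
  by apply: dvdp_sub; [exact: dvdp_mulr | exact: dvdp_mull].
have three_axes (e1 e2 e3 : {poly R}) :
    e1 ^+ 2 = Y ^+ 2 -> e2 ^+ 2 = Y ^+ 2 -> e3 ^+ 2 = Y ^+ 2 ->
    N %| e1 * a2 + t * a3 -> N %| e2 * a3 + t * a1 -> N %| e3 * a1 + t * a2 -> N %| a2.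
  move=> E1 E2 E3 H1 H2 H3; have E : (e1 * e2 * e3) ^+ 2 = Y ^+ 6.
    by rewrite !exprMn E1 E2 E3; ring.
  do 6!rewrite -cY; rewrite -c2.
  have -> : 2 * (Y * (Y * (Y * (Y * (Y * (Y * a2)))))) =
    (e1 * e2 * e3 + t * Y ^+ 2) * (e2 * e3 * (e1 * a2 + t * a3)
       - t * e3 * (e2 * a3 + t * a1) + t ^+ 2 * (e3 * a1 + t * a2) - N * (t * a2))
    + N * (Y ^+ 4 * a2).
    transitivity (((e1 * e2 * e3) ^+ 2 - t ^+ 2 * Y ^+ 4) * a2 + N * (Y ^+ 4 * a2)).
      by rewrite E Ndef; ring.
    by rewrite Ndef; ring.
  apply: dvdp_add; last exact: dvdp_mulr.
  apply: dvdp_mull; apply: dvdp_sub; last exact: dvdp_mulr.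
  by apply: dvdp_add; [apply: dvdp_sub|]; apply: dvdp_mull.
pose bA p := dvdq N (qconj (lin p) * Quat 0 a1 a2 a3 * lin p).
have reduceA e u v : e ^+ 2 = y ^+ 2 ->
    N %| u * (t ^+ 2 - e%:P ^+ 2) - 2 * t * e%:P * v -> N %| e%:P * u + t * v.
  move=> ee H; rewrite -cY -cY -c2.
  have eE : e%:P ^+ 2 = Y ^+ 2 :> {poly R} by rewrite -!rmorphXn ee.
  have -> : 2 * (Y * (Y * (e%:P * u + t * v))) =
      N * (e%:P * u) - e%:P * (u * (t ^+ 2 - e%:P ^+ 2) - 2 * t * e%:P * v).
    transitivity (2 * (Y ^+ 2 * (e%:P * u + t * v))); first by ring.
    by rewrite Ndef -eE; ring.
  by apply: dvdp_sub; [exact: dvdp_mulr | exact: dvdp_mull].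
have bA1 e : e ^+ 2 = y ^+ 2 -> bA (Quat x e 0 0) -> N %| e%:P * a2 + t * a3.
  move=> ee; rewrite /bA dvdqE => /and4P[_ _ Nc _]; apply: reduceA => //.
  apply: etrans Nc; congr (_ %| _).
  by rewrite /lin /cst /qconj /t !quatE /= polyC0; ring.
have bA2 e : e ^+ 2 = y ^+ 2 -> bA (Quat x 0 e 0) -> N %| e%:P * a3 + t * a1.
  move=> ee; rewrite /bA dvdqE => /and4P[_ _ _ Nc]; apply: reduceA => //.
  apply: etrans Nc; congr (_ %| _).
  by rewrite /lin /cst /qconj /t !quatE /= polyC0; ring.
have bA3 e : e ^+ 2 = y ^+ 2 -> bA (Quat x 0 0 e) -> N %| e%:P * a1 + t * a2.
  move=> ee; rewrite /bA dvdqE => /and4P[_ Nc _ _]; apply: reduceA => //.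
  apply: etrans Nc; congr (_ %| _).
  by rewrite /lin /cst /qconj /t !quatE /= polyC0; ring.
have ct f : N %| t * f -> N %| f.
  move=> Ntf; rewrite -cY -cY.
  have -> : Y * (Y * f) = N * f - t * (t * f) by rewrite Ndef; ring.
  by apply: dvdp_sub; [exact: dvdp_mulr | exact: dvdp_mull].
have ce e f : e ^+ 2 = y ^+ 2 -> N %| e%:P * f -> N %| f.
  move=> ee; rewrite mul_polyC dvdpZr // -sqrf_eq0 ee sqrf_eq0 //.
have yy : y ^+ 2 = y ^+ 2 by []. have nyny : (- y) ^+ 2 = y ^+ 2 by rewrite sqrrN.
have all0 : N %| a1 -> N %| a2 -> N %| a3 -> false.
  by move=> N1 N2 N3; move: nA; rewrite dvdqE dvdp0 N1 N2 N3.
have negY : (- y)%:P = - Y by rewrite polyCN.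
have i_pair : bA (Quat x y 0 0) -> bA (Quat x (- y) 0 0) -> (N %| a2) && (N %| a3).
  by move=> /bA1-/(_ yy) H1 /bA1-/(_ nyny); rewrite negY; apply: two_root.
have j_pair : bA (Quat x 0 y 0) -> bA (Quat x 0 (- y) 0) -> (N %| a3) && (N %| a1).
  by move=> /bA2-/(_ yy) H1 /bA2-/(_ nyny); rewrite negY; apply: two_root.
have i_j e : e ^+ 2 = y ^+ 2 -> N %| a2 -> N %| a3 -> bA (Quat x 0 e 0) -> false.
  move=> ee N2 N3 /bA2-/(_ ee); rewrite (dvdp_addr _ (dvdp_mull _ N3)) => /ct N1.
  exact: all0.
have i_k : N %| a2 -> N %| a3 -> bA (Quat x 0 0 y) -> false.
  move=> N2 N3 /bA3-/(_ yy); rewrite (dvdp_addl _ (dvdp_mull _ N2)) => /(ce _ _ yy) N1.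
  exact: all0.
have j_i e : e ^+ 2 = y ^+ 2 -> N %| a3 -> N %| a1 -> bA (Quat x e 0 0) -> false.
  move=> ee N3 N1 /bA1-/(_ ee); rewrite (dvdp_addl _ (dvdp_mull _ N3)) => /(ce _ _ ee) N2.
  exact: all0.
have j_k : N %| a3 -> N %| a1 -> bA (Quat x 0 0 y) -> false.
  move=> N3 N1 /bA3-/(_ yy); rewrite (dvdp_addr _ (dvdp_mull _ N1)) => /ct N2.
  exact: all0.
have mix e e' : e ^+ 2 = y ^+ 2 -> e' ^+ 2 = y ^+ 2 ->
    bA (Quat x e 0 0) -> bA (Quat x 0 e' 0) -> bA (Quat x 0 0 y) -> false.
  move=> ee ee' /bA1-/(_ ee) H1 /bA2-/(_ ee') H2 /bA3-/(_ yy) H3.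
  have N2 : N %| a2.
    by apply: three_axes H1 H2 H3; rewrite -!rmorphXn ?ee ?ee'.
  apply: all0 => //.
    by move: H3; rewrite (dvdp_addl _ (dvdp_mull _ N2)) => /(ce _ _ yy).
  by move: H1; rewrite (dvdp_addr _ (dvdp_mull _ N2)) => /ct.
suff : (count bA (axis_points x y) <= 2)%N by [].
(* Any three of the five points contain an antipodal pair and a point of another axis,
   or one point of each axis. *)
rewrite /=; move: i_pair j_pair (i_j y yy) (i_j (- y) nyny) i_k (j_i y yy)
    (j_i (- y) nyny) j_k (mix y y yy yy) (mix y (- y) yy nyny) (mix (- y) y nyny yy)
    (mix (- y) (- y) nyny nyny).
  case: (bA (Quat x y 0 0)); case: (bA (Quat x (- y) 0 0)); case: (bA (Quat x 0 y 0));
  case: (bA (Quat x 0 (- y) 0)); case: (bA (Quat x 0 0 y)) => //; 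
  case: (N %| a1); case: (N %| a2); case: (N %| a3) => //= *; (suff: false by []); auto.
Qed.

(** Pigeonhole on five candidates: at most one annihilates [B1], at most one
    annihilates [B2] and at most two annihilate [A] in the sandwich. *)
Lemma generic_linear_factor N B1 B2 A : quadratic N -> ~~ dvdq N B1 ->
  ~~ dvdq N B2 -> ~~ dvdq N A -> q0 A = 0 ->
  exists p, [/\ nu (lin p) = N, ~~ dvdq N (B1 * lin p), ~~ dvdq N (B2 * lin p) &
    ~~ dvdq N (qconj (lin p) * A * lin p)].
Proof.
move=> qN nB1 nB2 nA A0; have [x [y [y0 NE]]] := quadratic_sqr qN.
pose s := axis_points x y.
pose bA p := dvdq N (qconj (lin p) * A * lin p).
have cA : (count bA s <= 2)%N.
  by rewrite /bA; case: (A) A0 nA => a0 a1 a2 a3 /= -> nA; apply: count_sandwich.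
have cB B : ~~ dvdq N B -> (count (fun p => dvdq N (B * lin p)%R) s <= 1)%N.
  move=> nB; apply: count_le1 => [|u v _ _]; first exact: axis_points_uniq.
  exact: dvdq_lin_uniq qN nB.
pose bad p := [|| dvdq N (B1 * lin p), dvdq N (B2 * lin p) | bA p].
have : ~~ all bad s.
  rewrite all_count; apply/negP => /eqP sE.
  have countU (a b : pred (quat R)) : (count (predU a b) s <= count a s + count b s)%N.
    by rewrite -count_predUI leq_addr.
  have : (count bad s <= 1 + (1 + 2))%N.
    apply: leq_trans (countU _ _) (leq_add (cB _ nB1) _).
    exact: leq_trans (countU _ _) (leq_add (cB _ nB2) cA).
  by rewrite sE.
rewrite -has_predC => /hasP[p ps]; rewrite /= !negb_or => /and3P[? ? ?].
by exists p; split=> //; rewrite (nu_axis_points ps) NE.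
Qed.

End Peel.

Section Extension.
Variable R : rcfType.
Implicit Types (c f g N : {poly R}) (p d : quat R) (Q D T E X A B : quat {poly R}).

Lemma defect_neq0 c Q D : motion_data c Q D -> defect c Q D != 0.
Proof. by move=> mD; rewrite gcdp_eq0 negb_and noroot_neq0 //; apply: md_noroot mD. Qed.

(** Multiplying by a generic [T] does not let [g] grow. Write the new [g] as [g w].
    If [N] divided [w], then [N g] would divide both [c] and [T^* (Q^* D) T]. But if
    [N g] divides [c], it does not divide [Q^* D], nor [T^* (Q^* D) T] for generic
    [T]. So [w] is prime to [N], and as [D T T^* Q^* = N D Q^*] and [T (T^* (Q^* D)
    T) T^* = N^2 Q^* D], the new [g] divides [Q^* D] and [D Q^*]. *)
Lemma extend_right N c Q D : quadratic N -> motion_data c Q D ->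
  ~~ dvdq (N * defect c Q D) (qconj Q * D) || ~~ (N * defect c Q D %| c) ->
  exists p, [/\ nu (lin p) = N, motion_data c (Q * lin p) (D * lin p) &
    defect c (Q * lin p) (D * lin p) %| defect c Q D].
Proof.
move=> qN mD nNg; have g0 := defect_neq0 mD; set g := defect c Q D in nNg g0 *.
have [gc gQD gDQ] : [/\ g %| c, dvdq g (qconj Q * D) & dvdq g (D * qconj Q)].
  by have := dvdpp g; rewrite {2}/g dvd_defect => /and3P[].
have [A AE] := dvdqP _ _ gQD; have [B BE] := dvdqP _ _ gDQ.
have A0 : q0 A = 0.
  apply/eqP; rewrite -(mulrI_eq0 _ (mulfI g0)) -q0Z -AE q0_mulC.
  by rewrite (md_motion mD).
have nQ : ~~ dvdq N Q.
  by apply: contra (quadratic_ndvd1 qN); apply: (md_primitive mD).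
have n1 : ~~ dvdq N 1.
  by rewrite -[1]scale1r dvdq_alg quadratic_ndvd1.
(* If [N] does not divide [c], respectively divides [Q^* D / g], a unit stands in. *)
pose D1 := if N %| c then D else 1.
have nD1 : ~~ dvdq N D1.
  rewrite /D1; case: ifP => // Nc.
  by apply: contra (quadratic_ndvd1 qN); apply: (md_reduced mD).
pose A1 := if dvdq N A then Quat 0 1 0 0 else A.
have nA1 : ~~ dvdq N A1.
  rewrite /A1; case: ifP => [_|->] //.
  rewrite dvdqE; apply/negP => /and4P[_ N1 _ _].
  by have := quadratic_ndvd1 qN; rewrite N1.
have A10 : q0 A1 = 0 by rewrite /A1; case: ifP.
have [p [Tn nQT nDT nTA]] := generic_linear_factor qN nQ nD1 nA1 A10.
exists p; have [T Tdef] : {T | T = lin p} by exists (lin p).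
rewrite -Tdef in Tn nQT nDT nTA *; split=> //.
  case: (mD) => cr pQ rD mot; split=> //.
  - exact: primitive_mulr qN Tn pQ nQT.
  - apply: jointly_reduced_mulr qN Tn rD _; rewrite negb_and -implybE.
    by apply/implyP => Nc; move: nDT; rewrite /D1 Nc.
  by rewrite mulr_common_qconj q0Z mot mulr0.
set h := defect c (Q * T) (D * T).
have TQDT : qconj (Q * T) * (D * T) = qconj T * (qconj Q * D) * T.
  by rewrite qconjM !mulrA.
have DTQ : D * T * qconj (Q * T) = N *: (D * qconj Q).
  by rewrite mulr_common_qconj Tn.
have gh : g %| h.
  by rewrite dvd_defect gc TQDT DTQ dvdqZ // andbT; apply/dvdqMr/dvdqMl.
have : h %| h by []; rewrite {2}/h dvd_defect TQDT DTQ => /and3P[hc hQD hDQ].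
have [w hE] := dvdpP _ _ gh; rewrite mulrC in hE.
have nNw : ~~ (N %| w).
  apply/negP => Nw; have Ngh : N * g %| h by rewrite hE mulrC dvdp_mul.
  move: nNg; rewrite (dvdp_trans Ngh hc) orbF; apply/negP/negPn.
  rewrite mulrC AE dvdq_scale2 //.
  have : dvdq (N * g) (qconj T * (qconj Q * D) * T) by apply: dvdq_trans Ngh hQD.
  rewrite AE -scalerAr -scalerAl mulrC dvdq_scale2 //.
  by apply: contraLR => nA; rewrite /A1 (negPf nA) in nTA.
have cwN : coprimep w N by rewrite coprimep_sym quadratic_coprime.
rewrite dvd_defect hc andTb; apply/andP; split.
  rewrite AE hE dvdq_scale2 // -(Gauss_dvdq _ cwN) -(Gauss_dvdq _ cwN).
  have -> : N *: (N *: A) = T * (qconj T * A * T) * qconj T.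
    rewrite -!mulrA mulr_qconj Tn -!scalerAr mulr1 mulrA mulr_qconj Tn.
    by rewrite -scalerAl mul1r.
  apply/dvdqMr/dvdqMl; rewrite -(dvdq_scale2 _ _ g0) -hE.
  by apply: etrans hQD; rewrite AE -scalerAr -scalerAl.
rewrite BE hE dvdq_scale2 // -(Gauss_dvdq _ cwN) -(dvdq_scale2 _ _ g0) -hE.
by rewrite scalerA mulrC -scalerA -BE.
Qed.

End Extension.

(** * Polynomials with dual quaternion coefficients *)

Section Transport.
Variable R : comNzRingType.
Implicit Types (p q : {poly quat R}) (M L : {poly dquat R}).

Definition quat_of_poly p : quat {poly R} :=
  Quat (map_poly (@q0 R) p) (map_poly (@q1 R) p) (map_poly (@q2 R) p) (map_poly (@q3 R) p).

Lemma quat_of_polyM p q : quat_of_poly (p * q) = quat_of_poly p * quat_of_poly q.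
Proof.
apply: quat_eqP => /=; apply/polyP => i.
all: rewrite !(coefD, coefN) !coefM coef_map_id0 // coefM.
- rewrite (big_morph (@q0 R) (id1 := 0) (op1 := +%R)) // -!sumrB.
  by apply: eq_bigr => j _; rewrite !coef_map_id0.
- rewrite (big_morph (@q1 R) (id1 := 0) (op1 := +%R)) // -!sumrN -!big_split.
  by apply: eq_bigr => j _; rewrite !coef_map_id0.
- rewrite (big_morph (@q2 R) (id1 := 0) (op1 := +%R)) // -!sumrN -!big_split.
  by apply: eq_bigr => j _; rewrite !coef_map_id0.
rewrite (big_morph (@q3 R) (id1 := 0) (op1 := +%R)) // -!sumrN -!big_split.
by apply: eq_bigr => j _; rewrite !coef_map_id0.
Qed.

Lemma quat_of_polyD p q : quat_of_poly (p + q) = quat_of_poly p + quat_of_poly q.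
Proof.
by apply: quat_eqP => /=; apply/polyP => i; rewrite coefD !coef_map_id0 // coefD.
Qed.

Lemma quat_of_poly_inj : injective quat_of_poly.
Proof.
move=> p q [e0 e1 e2 e3]; apply/polyP => i.
have /= E0 := congr1 (fun f : {poly R} => f`_i) e0; move: E0.
have /= E1 := congr1 (fun f : {poly R} => f`_i) e1; move: E1.
have /= E2 := congr1 (fun f : {poly R} => f`_i) e2; move: E2.
have /= E3 := congr1 (fun f : {poly R} => f`_i) e3; move: E3.
rewrite !coef_map_id0 // => ? ? ? ?; exact: quat_eqP.
Qed.

Lemma quat_of_poly_conj p :
  quat_of_poly (map_poly (@qconj R) p) = qconj (quat_of_poly p).
Proof.
have c0 : qconj 0 = 0 :> quat R by exact: qconj0.
by apply: quat_eqP => /=; apply/polyP => i; rewrite ?coefN !coef_map_id0.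
Qed.

Lemma quat_of_poly_real (f : {poly R}) : quat_of_poly (realp (quat R) f) = f%:A.
Proof.
have a0 : in_alg (quat R) 0 = 0 by rewrite /= scale0r.
by apply: quat_eqP => /=; rewrite ?mulr0 ?mulr1; apply/polyP => i;
  rewrite ?coef0 !coef_map_id0 //= ?mulr0 ?mulr1.
Qed.

Definition poly_of_quat (q : quat {poly R}) : {poly quat R} :=
  \poly_(i < maxn (maxn (size (q0 q)) (size (q1 q))) (maxn (size (q2 q)) (size (q3 q))))
    Quat (q0 q)`_i (q1 q)`_i (q2 q)`_i (q3 q)`_i.

Lemma poly_of_quatK : cancel poly_of_quat quat_of_poly.
Proof.
move=> q; apply: quat_eqP => /=; apply/polyP => i.
all: rewrite coef_map_id0 // coef_poly; case: ltnP => // ; rewrite !geq_max.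
all: by move=> /andP[/andP[? ?] /andP[? ?]]; rewrite nth_default.
Qed.

(** The isomorphism of [DH[t]] with the dual quaternions over [R[t]]. *)
Definition dquat_of_poly M : dquat {poly R} :=
  DQuat (quat_of_poly (map_poly (@primal R) M)) (quat_of_poly (map_poly (@dual R) M)).

Lemma map_primalM M L :
  map_poly (@primal R) (M * L) = map_poly (@primal R) M * map_poly (@primal R) L.
Proof.
apply/polyP => i; rewrite coef_map_id0 // !coefM.
rewrite (big_morph (@primal R) (id1 := 0) (op1 := +%R)) //.
by apply: eq_bigr => j _; rewrite !coef_map_id0.
Qed.

Lemma map_dualM M L :
  map_poly (@dual R) (M * L) = map_poly (@primal R) M * map_poly (@dual R) L
    + map_poly (@dual R) M * map_poly (@primal R) L.
Proof.
apply/polyP => i; rewrite coef_map_id0 // coefD !coefM.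
rewrite (big_morph (@dual R) (id1 := 0) (op1 := +%R)) // -big_split.
by apply: eq_bigr => j _; rewrite !coef_map_id0.
Qed.

Lemma dquat_of_polyM M L : dquat_of_poly (M * L) = dquat_of_poly M * dquat_of_poly L.
Proof.
by rewrite dqmulE /dquat_of_poly map_primalM map_dualM quat_of_polyD !quat_of_polyM.
Qed.

Lemma dquat_of_poly_inj : injective dquat_of_poly.
Proof.
move=> M L ML.
have eP := quat_of_poly_inj (congr1 (@primal _) ML).
have eD := quat_of_poly_inj (congr1 (@dual _) ML).
apply/polyP => i; move/(congr1 (fun f : {poly quat R} => f`_i)): eP.
move/(congr1 (fun f : {poly quat R} => f`_i)): eD; rewrite /= !coef_map_id0 //.
by case: (M`_i) => ? ?; case: (L`_i) => ? ? /= -> ->.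
Qed.

Lemma dquat_of_poly_conj M :
  dquat_of_poly (map_poly (@dqconj R) M) = dqconj (dquat_of_poly M).
Proof.
have c0 : dqconj 0 = 0 :> dquat R by rewrite /dqconj /= qconj0.
rewrite /dqconj /= -!quat_of_poly_conj; congr DQuat; congr quat_of_poly.
  by apply/polyP => i; rewrite !coef_map_id0 // qconj0.
by apply/polyP => i; rewrite !coef_map_id0 // qconj0.
Qed.

Lemma coef_poly_of_parts p q i : (poly_of_parts p q)`_i = DQuat p`_i q`_i.
Proof.
rewrite /poly_of_parts coefD coefCM !coef_map_id0 // dqmulE dqaddE.
by rewrite mul0r mul0r mul1r addr0 !add0r.
Qed.

Lemma dquat_of_parts p q :
  dquat_of_poly (poly_of_parts p q) = DQuat (quat_of_poly p) (quat_of_poly q).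
Proof.
by congr DQuat; congr quat_of_poly; apply/polyP => i;
  rewrite coef_map_id0 // coef_poly_of_parts.
Qed.

Lemma dquat_of_poly_surj (m : dquat {poly R}) : exists M, dquat_of_poly M = m.
Proof.
case: m => p d; exists (poly_of_parts (poly_of_quat p) (poly_of_quat d)).
by rewrite dquat_of_parts !poly_of_quatK.
Qed.

Lemma dquat_of_poly_real (f : {poly R}) :
  dquat_of_poly (realp (dquat R) f) = DQuat f%:A 0.
Proof.
rewrite -quat_of_poly_real -[in RHS](_ : quat_of_poly 0 = 0); last first.
  by apply: quat_eqP => /=; rewrite map_poly0.
have a0 : in_alg (dquat R) 0 = 0 by rewrite /= scale0r.
have b0 : in_alg (quat R) 0 = 0 by rewrite /= scale0r.
congr DQuat; congr quat_of_poly; apply/polyP => i; rewrite ?coef0 !coef_map_id0 //=.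
by rewrite scaler0.
Qed.

Lemma dquat_of_poly1 : dquat_of_poly 1 = 1.
Proof. 
have -> : 1 = realp (dquat R) 1 by rewrite /realp rmorph1.
by rewrite dquat_of_poly_real scale1r.
Qed.

End Transport.

(** * Factorizations *)

Section Factorization.
Variable R : rcfType.
Implicit Types (c f g w N : {poly R}) (p : quat R) (h : dquat R).
Implicit Types (P Q D T : quat {poly R}) (m : dquat {poly R}) (M : {poly dquat R}).

(** Factorization into monic linear motion polynomials, read through
    [dquat_of_poly]. *)
Definition splits m := exists s : seq (dquat R),
  {in s, forall h, motion_center h} /\ m = \prod_(h <- s) dual_linear h.

Lemma splits1 : splits 1.
Proof. by exists [::]; rewrite big_nil. Qed.

Lemma splits_mulr m h : motion_center h -> splits m -> splits (m * dual_linear h).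
Proof.
move=> mh [s [ms ->]]; exists (rcons s h); rewrite -cats1 big_cat big_seq1.
  split=> // k; rewrite mem_cat inE => /orP[/ms|/eqP->] //.
Qed.

Lemma dual_linear_conj h : dual_linear (dqconj h) = dqconj (dual_linear h).
Proof.
rewrite /dual_linear /dqconj /=; congr DQuat; last by rewrite qconjN cst_conj.
by rewrite /lin qconjD qconjN qconjZ qconj1 cst_conj.
Qed.

Lemma motion_center_conj h : motion_center h -> motion_center (dqconj h).
Proof.
move=> [h0 h1]; split=> //.
by rewrite /dqconj [dual _]/= [primal _]/= q0_mulC -qconjM q0_conj.
Qed.

Lemma splits_conj m : splits (dqconj m) -> splits m.
Proof.
move=> [s [ms mE]]; exists (map (@dqconj R) (rev s)); split.
  move=> h /mapP[k]; rewrite mem_rev => /ms mk ->; exact: motion_center_conj.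
rewrite -[m]dqconjK mE big_map; elim: s {ms mE} => [|h s IHs].
  by rewrite !big_nil /dqconj /= qconj0 qconj1.
by rewrite big_cons dqconjM IHs rev_cons -cats1 big_cat big_seq1 dual_linear_conj.
Qed.

Lemma dquat_of_linear h : dquat_of_poly ('X - h%:P) = dual_linear h.
Proof.
have coefL i : ('X - h%:P)`_i = (i == 1)%:R - (if i == 0 then h else 0).
  by rewrite coefB coefX coefC.
case: h coefL => [[a b c d] [a' b' c' d']] coefL.
rewrite /dquat_of_poly /dual_linear /lin /cst !quatE /=; congr DQuat;
  apply: quat_eqP; rewrite /= ?mulr0 ?mulr1; apply/polyP => i; do 2!rewrite coef_map_id0 //;
  rewrite coefL ?coefD ?coefN ?coef0 ?coefX ?coefC;
  case: i => [|[|i]] //=; rewrite /= ?subr0 ?sub0r ?oppr0 //.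
Qed.

Lemma exists_right_quotient M m h : M \is monic ->
  dquat_of_poly M = m * dual_linear h ->
  exists L, [/\ L \is monic, dquat_of_poly L = m & size M = (size L).+1].
Proof.
move=> mM ME; have [L LE] := dquat_of_poly_surj m.
have {}ME : M = L * ('X - h%:P).
  by apply: dquat_of_poly_inj; rewrite dquat_of_polyM LE dquat_of_linear.
have mX := monicXsubC h.
have mL : L \is monic by have := monicMr L mX; rewrite -ME mM => <-.
exists L; split=> //.
by have := size_Mmonic (monic_neq0 mL) mX; rewrite -ME size_XsubC addn2 => ->.
Qed.

Lemma monic_size1 (S : nzRingType) (p : {poly S}) : p \is monic -> (size p <= 1)%N -> p = 1.
Proof.
move=> /monicP mp sp; rewrite (size1_polyC sp); congr polyC.
by rewrite -mp lead_coefE; case: (size p) sp => [|[]].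
Qed.

Lemma size1_splits M : M \is monic -> (size M <= 1)%N -> splits (dquat_of_poly M).
Proof. by move=> mM sM; rewrite (monic_size1 mM sM) dquat_of_poly1; apply: splits1. Qed.

Lemma dqconj0 : dqconj 0 = 0 :> dquat R.
Proof. by rewrite /dqconj /= qconj0. Qed.

Lemma dqconj1 : dqconj 1 = 1 :> dquat R.
Proof. by rewrite /dqconj /= qconj0 qconj1. Qed.

Lemma size_conj M : size (map_poly (@dqconj R) M) = size M.
Proof. apply: size_map_inj_poly; [exact: (can_inj (@dqconjK R)) | exact: dqconj0]. Qed.

Lemma monic_conj M : M \is monic -> map_poly (@dqconj R) M \is monic.
Proof.
move=> /monicP mM; apply/monicP; rewrite lead_coefE size_conj.
by have := coef_map_id0 M (size M).-1 dqconj0; rewrite -lead_coefE mM dqconj1.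
Qed.

(** A real root of a sum of four squares is a common root. *)
Lemma primitive_norm_noroot P : primitive P -> forall x, ~~ root (nu P) x.
Proof.
move=> pP x; apply/negP => /rootP; rewrite /nu !hornerD !horner_exp => /eqP.
rewrite !paddr_eq0 ?addr_ge0 ?sqr_ge0 // !sqrf_eq0 -!andbA => /and4P[r0 r1 r2 r3].
have : 'X - x%:P %| 1 by apply: pP; rewrite dvdqE !dvdp_XsubCl; apply/and4P; split.
by rewrite dvdp1 size_XsubC.
Qed.

(** [M M^*] is the real polynomial [nu P], and [M] is monic. *)
Lemma size_norm_gt1 M P D : M \is monic -> dquat_of_poly M = DQuat P D ->
  q0 (D * qconj P) = 0 -> (1 < size M)%N -> (1 < size (nu P))%N.
Proof.
move=> mM ME mot sM; rewrite ltnNge; apply/negP => sP.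
have MM : M * map_poly (@dqconj R) M = realp (dquat R) (nu P).
  apply: dquat_of_poly_inj; rewrite dquat_of_polyM dquat_of_poly_conj ME.
  by rewrite mulr_dqconj mot mul0rn scale0r dquat_of_poly_real.
have := congr1 (fun p : {poly dquat R} => size p) MM.
rewrite /= size_realp size_monicM //; last by rewrite -size_poly_gt0 size_conj ltnW.
rewrite size_conj => E; move: sP; rewrite -E leqNgt => /negP; apply.
by case: (size M) sM => [|[|k]] // _; rewrite addnS /= addSn ltnS.
Qed.

(** The norm of a primitive [P] has no real root, so it has a quadratic factor [N]
    unless it is constant, and [N] does not divide [P]. A right factor splits off,
    and the primal part of the quotient, a left factor of [P], is again
    primitive. *)
Lemma primitive_splits n M P D : (size M <= n)%N -> M \is monic ->
  dquat_of_poly M = DQuat P D -> primitive P -> q0 (D * qconj P) = 0 ->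
  splits (dquat_of_poly M).
Proof.
elim: n M P D => [|n IHn] M P D sn mM ME pP mot.
  by apply: size1_splits => //; apply: leq_trans sn _.
have [sM|sM] := leqP (size M) 1; first exact: size1_splits.
have rP := primitive_norm_noroot pP.
have [N qN NP] := exists_quadratic (noroot_neq0 rP) (size_norm_gt1 mM ME mot sM) rP.
have nP : ~~ dvdq N P by apply: contra (quadratic_ndvd1 qN); apply: pP.
have ND : N %| q0 (D * qconj P) by rewrite mot dvdp0.
have [h [mh Tn [m mE]]] := split_linear_factor qN NP ND nP.
rewrite mE in ME; have [L [mL LE sL]] := exists_right_quotient mM ME.
rewrite ME -LE; apply: splits_mulr => //.
case: m mE LE {ME} => P' D'; rewrite dqmulE => -[PE DE] LE.
apply: (IHn L P' D') => //; first by rewrite -ltnS -sL.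
  by move=> f fP; apply: pP; rewrite PE dvdqMr.
have [T Tdef] : {T | T = lin (primal h)} by exists (lin (primal h)).
rewrite -Tdef in PE DE Tn; have N0 := quadratic_neq0 qN.
have dT : q0 (cst (dual h) * qconj T) = 0.
  by case: mh => h0 h1; rewrite Tdef q0_cst_lin h0 h1 scale0r subr0.
apply/eqP; rewrite -(mulrI_eq0 _ (mulfI N0)) -q0Z.
have -> : N *: (D' * qconj P') = D * qconj P + P' * (cst (dual h) * qconj T) * qconj P'.
  rewrite DE PE qconjM mulrDl !mulrA addrAC mulrN !mulNr addNr add0r.
  by rewrite -[D' * T * _]mulrA mulr_qconj Tn -scalerAr mulr1 -scalerAl.
rewrite q0D mot add0r q0_mulC [qconj P' * _]mulrA qconj_mulr -scalerAl mul1r q0Z dT mulr0 //.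
Qed.

(** As long as [c] is not constant a linear factor splits off on the left or on the
    right without losing the norm condition; for constant [c] the primal part is
    primitive. *)
Lemma norm_condition_splits n M c Q D : (size M <= n)%N -> M \is monic ->
  dquat_of_poly M = DQuat (c *: Q) D -> motion_data c Q D ->
  c * defect c Q D %| nu D -> splits (dquat_of_poly M).
Proof.
elim: n M c Q D => [|n IHn] M c Q D sn mM ME mD cgD.
  by apply: size1_splits => //; apply: leq_trans sn _.
have c0 := noroot_neq0 (md_noroot mD).
have [sc|sc] := leqP (size c) 1.
  apply: (primitive_splits sn mM ME).
    have cfc f : coprimep f c.
      rewrite (size1_polyC sc) -alg_polyC coprimepZr ?coprimep1 // -polyC_eq0.
      by rewrite -(size1_polyC sc).
    by move=> f; rewrite (Gauss_dvdq _ (cfc f)) => /(md_primitive mD).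
  by rewrite qconjZ -scalerAr q0Z (md_motion mD) mulr0.
have [N qN Nc] := exists_quadratic c0 sc (md_noroot mD).
have peel M' Q' D' : (size M' <= n.+1)%N -> M' \is monic ->
    dquat_of_poly M' = DQuat (c *: Q') D' -> peels c Q' D' -> splits (dquat_of_poly M').
  move=> sn' mM' ME' [h [c1 [Q1 [D1 [mh mD1 cgD1 E]]]]].
  rewrite E in ME'; have [L [mL LE sL]] := exists_right_quotient mM' ME'.
  rewrite ME' -LE; apply: splits_mulr => //.
  by apply: (IHn L c1 Q1 D1) => //; rewrite -ltnS -sL.
have [] := peels_or_conj qN mD cgD Nc; first exact: peel.
move=> pc; apply: splits_conj; rewrite -dquat_of_poly_conj; apply: peel pc.
- by rewrite size_conj.
- exact: monic_conj.
by rewrite dquat_of_poly_conj ME /dqconj /= qconjZ.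
Qed.

(** For a quadratic factor [N] of [w], a suitable [T] with [nu T = N] trades [w M]
    for [(w / N) (M T)], whose product with [T^*] is [w M]. Only when [N g] divides
    both [c] and [Q^* D] does [T] have to be put on the left of [M]. *)
Lemma multiple_splits n w M c Q D : (size w <= n)%N -> w \is monic ->
  (forall x, ~~ root w x) -> M \is monic ->
  dquat_of_poly M = DQuat (c *: Q) D -> motion_data c Q D ->
  c * defect c Q D %| w * nu D -> splits (w *: dquat_of_poly M).
Proof.
elim: n w M c Q D => [|n IHn] w M c Q D sn mw rw mM ME mD cgD.
  by move: sn; rewrite leqn0 size_poly_eq0 (negPf (monic_neq0 mw)).
have [sw|sw] := leqP (size w) 1.
  have w1 := monic_size1 mw sw.
  rewrite w1 scale1r; apply: norm_condition_splits ME mD _ => //.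
  by rewrite w1 mul1r in cgD.
have [N qN /dvdpP[w' wE]] := exists_quadratic (monic_neq0 mw) sw rw.
have [mN sN _] := qN; have N0 := quadratic_neq0 qN.
have mw' : w' \is monic by have := monicMr w' mN; rewrite -wE mw => <-.
have rw' : forall x, ~~ root w' x by apply: noroot_dvd rw; rewrite wE dvdp_mulr.
have sw' : (size w' <= n)%N.
  by move: sn; rewrite wE size_Mmonic ?monic_neq0 // sN addn3 /=; apply: ltnW.
have extend L Q' D' : L \is monic -> dquat_of_poly L = DQuat (c *: Q') D' ->
    motion_data c Q' D' -> c * defect c Q' D' %| w * nu D' ->
    ~~ dvdq (N * defect c Q' D') (qconj Q' * D') || ~~ (N * defect c Q' D' %| c) ->
    splits (w *: dquat_of_poly L).
  move=> mL LE mD' cgD' nNg.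
  have [p [Tn mDT ggT]] := extend_right qN mD' nNg.
  pose h := DQuat p 0; pose hc := dqconj h.
  have mh : motion_center h by apply: motion_center_quat.
  have -> : w *: dquat_of_poly L =
      (w' *: dquat_of_poly (L * ('X - h%:P))) * dual_linear hc.
    rewrite dquat_of_polyM dquat_of_linear dual_linear_conj -scalerAl -mulrA.
    rewrite dual_linear_quat mulr_dqconj mul0r mul0rn scale0r Tn.
    have -> : DQuat (N *: 1) 0 = N *: 1 :> dquat {poly R} by rewrite dqscaleE scaler0.
    by rewrite -scalerAr mulr1 scalerA wE.
  apply: splits_mulr; first exact: motion_center_conj.
  have mLX : L * ('X - h%:P) \is monic.
    by have := monicMr L (monicXsubC h); rewrite mL.
  apply: (IHn w' (L * ('X - h%:P)) c (Q' * lin p) (D' * lin p)); rewrite ?sw' //.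
    rewrite dquat_of_polyM dquat_of_linear LE dual_linear_quat dqmulE mulr0 add0r.
    by rewrite scalerAl.
  have -> : w' * nu (D' * lin p) = w * nu D' by rewrite nuM Tn wE; ring.
  exact: dvdp_trans (dvdp_mul (dvdpp c) ggT) cgD'.
have [nQD|] := boolP (~~ dvdq (N * defect c Q D) (qconj Q * D) || ~~ (N * defect c Q D %| c)).
  exact: extend nQD.
rewrite negb_or !negbK => /andP[NgQD Ngc].
apply: splits_conj; have -> : dqconj (w *: dquat_of_poly M) = w *: dqconj (dquat_of_poly M).
  by case: (dquat_of_poly M) => a b; rewrite dqscaleE /dqconj /= !qconjZ.
rewrite -dquat_of_poly_conj; apply: (extend _ (qconj Q) (qconj D)).
- exact: monic_conj.
- by rewrite dquat_of_poly_conj ME /dqconj /= qconjZ.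
- exact: motion_data_conj.
- by rewrite nu_conj; apply: norm_condition_conj.
apply/orP; left; apply: contraT; rewrite negbK -qconjM dvdq_conj => NgDQ.
have Ngg : N * defect c Q D %| defect c Q D.
  rewrite dvd_defect Ngc NgQD andTb; apply: dvdq_trans NgDQ.
  by rewrite dvdp_mul // -dvd_defect_conj !qconjK.
have := quadratic_ndvd1 qN.
by rewrite -(dvdp_mul2r _ _ (defect_neq0 mD)) mul1r Ngg.
Qed.

End Factorization.

(** * The theorem on real multiples *)

Section Bridge.
Variable R : realType.
Implicit Types (f c : {poly R}) (P Q D : {poly quat R}) (M : {poly dquat R}).

Lemma realp_dvd_quat f P : realp_dvd f P <-> dvdq f (quat_of_poly P).
Proof.
split=> [[P' ->]|/dvdqP[r E]].
  by rewrite quat_of_polyM quat_of_poly_real -scalerAl mul1r dvdq_scale.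
exists (poly_of_quat r); apply: quat_of_poly_inj.
by rewrite quat_of_polyM quat_of_poly_real poly_of_quatK -scalerAl mul1r.
Qed.

Lemma dvdp_realp f c : dvdq f (quat_of_poly (realp (quat R) c)) = (f %| c).
Proof. by rewrite quat_of_poly_real dvdq_alg. Qed.

Lemma mrpf1_primitive P : P != 0 -> mrpf [:: P] = 1 -> primitive (quat_of_poly P).
Proof.
move=> P0 P1 f fP; have [_ _ max] := mrpfP (mem_head P [::]) P0.
rewrite -P1; apply: max => N; rewrite inE => /eqP->.
exact/realp_dvd_quat.
Qed.

(** A common divisor of [c] and [D] divides both parts of [M]. *)
Lemma mrpf1_jointly_reduced M c q d : M != 0 -> mrpf [:: M] = 1 ->
  dquat_of_poly M = DQuat (c *: q) d -> jointly_reduced c d.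
Proof.
move=> M0 M1 ME f fc /dvdqP[d' dE]; have [_ _ max] := mrpfP (mem_head M [::]) M0.
rewrite -M1; apply: max => N; rewrite inE => /eqP->.
have /dvdpP[k cE] := fc; have [M' M'E] := dquat_of_poly_surj (DQuat (k *: q) d').
exists M'; apply: dquat_of_poly_inj; rewrite dquat_of_polyM dquat_of_poly_real M'E ME.
rewrite dqmulE mul0r addr0 -!scalerAl !mul1r scalerA dE cE.
by congr DQuat; congr (_ *: _); rewrite mulrC.
Qed.

(** The dual part of [M M^*] vanishes because the norm of [M] is real. *)
Lemma motion_poly_parts M p d : motion_poly M -> dquat_of_poly M = DQuat p d ->
  nu p != 0 /\ q0 (d * qconj p) = 0.
Proof.
move=> [F F0 MF] ME; have := congr1 (@dquat_of_poly R) MF.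
rewrite dquat_of_polyM dquat_of_poly_conj ME mulr_dqconj dquat_of_poly_real => E.
have q0_alg (a : {poly R}) : q0 (a%:A : quat {poly R}) = a by rewrite q0Z mulr1.
split.
  have : q0 (primal (DQuat (nu p)%:A ((q0 (d * qconj p) *+ 2)%:A))) = q0 (F%:A : quat {poly R}).
    by rewrite E.
  by rewrite !q0_alg => ->.
have : q0 (dual (DQuat (nu p)%:A ((q0 (d * qconj p) *+ 2)%:A))) = 0 by rewrite E.
rewrite q0_alg => /eqP; rewrite -mulr_natl mulf_eq0 -polyC_natr polyC_eq0 pnatr_eq0.
by move=> /eqP.
Qed.

Lemma splits_has_factorization M :
  splits (dquat_of_poly M) -> has_linear_factorization M.
Proof.
move=> [s [ms ME]]; exists s; split.
  move=> h /ms [h0 h1]; exists (nu (lin (primal h))).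
    by rewrite -size_poly_eq0 size_nu_lin.
  apply: dquat_of_poly_inj; rewrite dquat_of_polyM dquat_of_poly_conj dquat_of_linear.
  rewrite /dual_linear mulr_dqconj dquat_of_poly_real mulNr q0N q0_cst_lin h0 h1.
  by rewrite scale0r subr0 oppr0 mul0rn scale0r.
apply: dquat_of_poly_inj; rewrite ME (big_morph _ (@dquat_of_polyM R) (@dquat_of_poly1 R)).
by apply: eq_bigr => h _; rewrite dquat_of_linear.
Qed.

End Bridge.

Theorem corollary3 (R : realType) (M : {poly dquat R}) (c : {poly R})
    (Q D : {poly quat R})
    (Mmonic : M \is monic) (Mreduced : reduced M) (Mmotion : motion_poly M)
    (Mbounded : bounded M)
    (Mdef : M = poly_of_parts (realp (quat R) c * Q) D)
    (cmonic : c \is monic) (Qreduced : mrpf [:: Q] = 1) :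
  let Qc := map_poly (@qconj R) Q in
  let g := mrpf [:: realp (quat R) c; Qc * D; D * Qc] in
  let g' := (c * g) %/ mrpf [:: realp (quat R) (c * g); qnorm D] in
  has_linear_factorization (M * realp (dquat R) g').
Proof.
move=> Qc g g'.
have ME : dquat_of_poly M = DQuat (c *: quat_of_poly Q) (quat_of_poly D).
  by rewrite Mdef dquat_of_parts quat_of_polyM quat_of_poly_real -scalerAl mul1r.
have [N0 mot] := motion_poly_parts Mmotion ME.
have c0 := monic_neq0 cmonic.
have Q0 : Q != 0.
  apply: contraNneq N0 => ->; have -> : quat_of_poly 0 = 0 :> quat {poly R}.
    by apply: quat_eqP => /=; rewrite map_poly0.
  by rewrite scaler0 nu0.
have P0 : primal_part M != 0.
  apply: contraNneq N0 => P0.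
  have /= <- : primal (dquat_of_poly M) = c *: quat_of_poly Q by rewrite ME.
  rewrite -/(primal_part M) P0.
  by rewrite /quat_of_poly !map_poly0; apply/eqP; exact: nu0.
have cr x : ~~ root c x.
  case: Mbounded => _ _ _ /(_ x); apply: contra => cx.
  have [_ _ max] := mrpfP (mem_head (primal_part M) [::]) P0.
  rewrite -dvdp_XsubCl; apply: max => N; rewrite inE => /eqP->; apply/realp_dvd_quat.
  have -> : quat_of_poly (primal_part M) = primal (dquat_of_poly M) by [].
  by rewrite ME dvdq_scale // dvdp_XsubCl.
have mD : motion_data c (quat_of_poly Q) (quat_of_poly D).
  split=> //.
  - exact: mrpf1_primitive.
  - exact: mrpf1_jointly_reduced (monic_neq0 Mmonic) Mreduced ME.
  - move: mot; rewrite qconjZ -scalerAr q0Z => /eqP.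
    by rewrite mulf_eq0 (negPf c0) => /eqP.
have realp0 f : f != 0 -> realp (quat R) f != 0.
  by rewrite -!size_poly_eq0 size_realp.
have [gmon gdvd gmax] := mrpfP (mem_head (realp (quat R) c) [:: Qc * D; D * Qc]) (realp0 _ c0).
rewrite -/g in gmon gdvd gmax.
have gE : defect c (quat_of_poly Q) (quat_of_poly D) %| g.
  apply: gmax => N; rewrite !inE => NE; apply/realp_dvd_quat.
  have := dvdpp (defect c (quat_of_poly Q) (quat_of_poly D)); rewrite {2}/defect -/(defect _ _ _).
  rewrite dvd_defect => /and3P[h1 h2 h3].
  case/or3P: NE => /eqP->; first by rewrite dvdp_realp.
    by rewrite quat_of_polyM quat_of_poly_conj.
  by rewrite quat_of_polyM quat_of_poly_conj.
have gc : g %| c.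
  by rewrite -dvdp_realp; apply/realp_dvd_quat; apply: gdvd; rewrite mem_head.
have cg0 : c * g != 0 by rewrite mulf_neq0 // monic_neq0.
have [kmon kdvd _] := mrpfP (mem_head (realp (quat R) (c * g)) [:: qnorm D]) (realp0 _ cg0).
set k := mrpf _ in kmon kdvd; rewrite -/k in g' *.
have kcg : k %| c * g.
  by rewrite -dvdp_realp; apply/realp_dvd_quat; apply: kdvd; rewrite mem_head.
have kD : k %| nu (quat_of_poly D).
  have : dvdq k (quat_of_poly (qnorm D)).
    by apply/realp_dvd_quat; apply: kdvd; rewrite !inE eqxx orbT.
  by rewrite quat_of_polyM quat_of_poly_conj mulr_qconj dvdq_alg.
have cgE : c * g = g' * k by rewrite /g' divpK.
have g'mon : g' \is monic.
  by have := monicMr g' kmon; rewrite -cgE monicMr // cmonic => <-.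
have g'r x : ~~ root g' x.
  have: ~~ root (c * g) x.
    by rewrite rootM negb_or cr; apply: noroot_dvd cr x.
  by rewrite cgE rootM negb_or => /andP[].
apply: splits_has_factorization.
have -> : dquat_of_poly (M * realp (dquat R) g') = g' *: dquat_of_poly M.
  rewrite dquat_of_polyM dquat_of_poly_real ME dqmulE dqscaleE mulr0 add0r.
  by rewrite -!scalerAr !mulr1.
apply: (multiple_splits (leqnn _) g'mon g'r Mmonic ME mD).
apply: dvdp_trans (dvdp_mul (dvdpp c) gE) _.
by rewrite cgE dvdp_mul.
Qed.
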